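(* Let $\beta\ge 1$ be an integer. Then \begin{align*} X_{K_{(3,2^\beta)}} =\beta!\Bigl(&\beta(2\beta+3)\,a_{\beta+1}\,e_{2\beta+3} +\beta\sum_{d=0}^{\beta-1}(2d+1)\,a_d\,e_{(\beta+2+d,\;\beta+1-d)}\\ &+\bigl(a_{\beta+1}+(2\beta^2+\beta-1)a_\beta\bigr)e_{(2\beta+2,\,1)} +e_{(\beta+1,\,\beta+1,\,1)}\\ &+\sum_{d=2}^{\beta}\bigl((4d-3)a_{d-1}+a_{d-2}\bigr)e_{(\beta+d+1,\;\beta+1-d,\;1)}\Bigr), \end{align*} where, for $d\ge 0$, $$a_d=\#\bigl\{f\colon[d]\to[2d]\ \text{injective}\ :\ f(i)\ne i\text{ for every }i\in[d]\bigr\}.$$ Consequently, the complete multipartite graph $K_{(3,2^\beta)}$ is $e$-positive.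
   Context: For $d\ge1$, $[d]=\{1,\dots,d\}$, and $[0]=\varnothing$ (so $a_0=1$). For a partition $\lambda$ of a positive integer, $K_\lambda$ is the complete multipartite graph whose partite sets have sizes equal to the parts of $\lambda$. The partition $(3,2^\beta)$ has one part equal to $3$ and $\beta$ parts equal to $2$. For a finite simple graph $G=(V,E)$, the chromatic symmetric function is $X_G(x)=\sum_{\kappa}\prod_{v\in V}x_{\kappa(v)}$, where $x=(x_1,x_2,\dots)$ are commuting indeterminates and the sum is over all proper colorings $\kappa\colon V\to\mathbb Z_{>0}$ (adjacent vertices get distinct colors). It lies in the ring of symmetric functions over $\mathbb Q$. $e_\mu=e_{\mu_1}e_{\mu_2}\cdots$ denotes the elementary symmetric function indexed by the partition $\mu$; $e_n$ means $e_{(n)}$. A graph $G$ is $e$-positive if all coefficients of $X_G$ in the basis $\{e_\mu\}$ are nonnegative. Empty sums are $0$. *)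

(* Defs.v *)
From HB Require Import structures.
From mathcomp Require Import all_boot all_order all_algebra all_fingroup.
From mathcomp Require Import finmap boolp.
From mathcomp Require Import mpoly.

Set Implicit Arguments.
Unset Strict Implicit.
Unset Printing Implicit Defensive.

Import Order.TTheory GRing.Theory Num.Theory.
Local Open Scope ring_scope.

(* The specialization x_n := 0, from n + 1 to n variables. *)
Definition drop_last (n : nat) (p : {mpoly rat[n.+1]}) : {mpoly rat[n]} :=
  p \mPo [tuple (if unlift ord_max i is Some j then 'X_j else 0) | i < n.+1].

(* The ring of symmetric functions over rat, as the inverse limit of the rings
   of symmetric polynomials in n variables (n -> oo) with respect to drop_last,
   restricted to families of bounded degree.  The component at n of a symmetric
   function f(x_0, x_1, ...) is f(x_0, ..., x_(n-1), 0, 0, ...). *)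
Definition is_symfun (f : forall n, {mpoly rat[n]}) : Prop :=
  [/\ forall n, f n \is symmetric,
      forall n, drop_last (f n.+1) = f n
    & exists d, forall n, (msize (f n) <= d)%N].

Record symfun := SymFun {
  in_vars :> forall n, {mpoly rat[n]};
  in_varsP : is_symfun in_vars }.

Lemma symfunP (f g : symfun) : (forall n, f n = g n) -> f = g.
Proof.
case: f g => [f fP] [g gP] /= fg.
have {}fg : f = g by apply: functional_extensionality_dep.
by case: _ / fg gP => gP; rewrite (Prop_irrelevance fP gP).
Qed.

HB.instance Definition _ := gen_eqMixin symfun.
HB.instance Definition _ := gen_choiceMixin symfun.

Section DropLast.
Variable n : nat.
Implicit Types p q : {mpoly rat[n.+1]}.

Lemma drop_last0 : drop_last (0 : {mpoly rat[n.+1]}) = 0.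
Proof. exact: comp_mpoly0. Qed.
Lemma drop_last1 : drop_last (1 : {mpoly rat[n.+1]}) = 1.
Proof. exact: comp_mpoly1. Qed.
Lemma drop_lastD p q : drop_last (p + q) = drop_last p + drop_last q.
Proof. exact: comp_mpolyD. Qed.
Lemma drop_lastN p : drop_last (- p) = - drop_last p.
Proof. exact: comp_mpolyN. Qed.
Lemma drop_lastM p q : drop_last (p * q) = drop_last p * drop_last q.
Proof. by rewrite /drop_last rmorphM. Qed.
Lemma drop_lastZ c p : drop_last (c *: p) = c *: drop_last p.
Proof. exact: comp_mpolyZ. Qed.
Lemma drop_last_sum I (r : seq I) (P : pred I) (F : I -> {mpoly rat[n.+1]}) :
  drop_last (\sum_(i <- r | P i) F i) = \sum_(i <- r | P i) drop_last (F i).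
Proof. by rewrite /drop_last raddf_sum. Qed.
Lemma drop_last_prod I (r : seq I) (P : pred I) (F : I -> {mpoly rat[n.+1]}) :
  drop_last (\prod_(i <- r | P i) F i) = \prod_(i <- r | P i) drop_last (F i).
Proof. by rewrite /drop_last rmorph_prod. Qed.
Lemma drop_lastX (i : 'I_n.+1) :
  drop_last 'X_i = if unlift ord_max i is Some j then 'X_j else 0.
Proof. by rewrite /drop_last comp_mpolyXU -tnth_nth tnth_mktuple. Qed.
Lemma drop_last_mwiden (p : {mpoly rat[n]}) : drop_last (mwiden p) = p.
Proof.
rewrite [p in LHS]mpolyE raddf_sum /= drop_last_sum [RHS]mpolyE.
apply: eq_bigr => m _; rewrite mwidenZ drop_lastZ mwidenX; congr (_ *: _).
rewrite mpolyXE_id drop_last_prod big_ord_recr /=.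
rewrite mnmwiden_ordmax expr0 {2}/drop_last comp_mpoly1 mulr1 [RHS]mpolyXE_id.
apply: eq_bigr => i _; rewrite mnmwiden_widen.
rewrite /drop_last rmorphXn /= -/(drop_last _) drop_lastX.
have -> : widen_ord (leqnSn n) i = lift ord_max i.
  by apply/val_inj; rewrite /= /bump leqNgt ltn_ord.
by rewrite liftK.
Qed.
End DropLast.

Lemma is_symfun0 : is_symfun (fun=> 0).
Proof.
split=> [n|n|] /=; [exact: rpred0 | exact: drop_last0 |].
by exists 0%N => n; rewrite msize0.
Qed.

Lemma is_symfun1 : is_symfun (fun=> 1).
Proof.
split=> [n|n|] /=; [exact: rpred1 | exact: drop_last1 |].
by exists 1%N => n; rewrite msize1.
Qed.

Lemma is_symfunD (f g : symfun) : is_symfun (fun n => f n + g n).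
Proof.
have [fS fD [d fd]] := in_varsP f; have [gS gD [d' gd]] := in_varsP g.
split=> [n|n|] /=; [exact: rpredD (fS n) (gS n) | by rewrite drop_lastD fD gD |].
exists (maxn d d') => n; apply: leq_trans (msizeD_le _ _) _.
by rewrite geq_max !leq_max fd gd orbT.
Qed.

Lemma is_symfunN (f : symfun) : is_symfun (fun n => - f n).
Proof.
have [fS fD [d fd]] := in_varsP f.
split=> [n|n|] /=; [by rewrite rpredN; exact: fS | by rewrite drop_lastN fD |].
by exists d => n; rewrite msizeN.
Qed.

Lemma is_symfunM (f g : symfun) : is_symfun (fun n => f n * g n).
Proof.
have [fS fD [d fd]] := in_varsP f; have [gS gD [d' gd]] := in_varsP g.
split=> [n|n|] /=; [exact: rpredM (fS n) (gS n) | by rewrite drop_lastM fD gD |].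
exists (d + d').+1%N => n; apply: leq_trans (msizeM_le _ _) _.
by rewrite ltnS leq_add.
Qed.

Lemma is_symfunZ (c : rat) (f : symfun) : is_symfun (fun n => c *: f n).
Proof.
have [fS fD [d fd]] := in_varsP f.
split=> [n|n|] /=; [exact: rpredZ (fS n) | by rewrite drop_lastZ fD |].
by exists d => n; apply: leq_trans (fd n); apply: msizeZ_le.
Qed.

Definition symfun0 := SymFun is_symfun0.
Definition symfun1 := SymFun is_symfun1.
Definition symfun_add f g := SymFun (is_symfunD f g).
Definition symfun_opp f := SymFun (is_symfunN f).
Definition symfun_mul f g := SymFun (is_symfunM f g).
Definition symfun_scale c f := SymFun (is_symfunZ c f).

Fact symfun_addA : associative symfun_add.
Proof. by move=> f g h; apply: symfunP => n; apply: addrA. Qed.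
Fact symfun_addC : commutative symfun_add.
Proof. by move=> f g; apply: symfunP => n; apply: addrC. Qed.
Fact symfun_add0 : left_id symfun0 symfun_add.
Proof. by move=> f; apply: symfunP => n; apply: add0r. Qed.
Fact symfun_addN : left_inverse symfun0 symfun_opp symfun_add.
Proof. by move=> f; apply: symfunP => n; apply: addNr. Qed.

HB.instance Definition _ := GRing.isZmodule.Build symfun
  symfun_addA symfun_addC symfun_add0 symfun_addN.

Fact symfun_mulA : associative symfun_mul.
Proof. by move=> f g h; apply: symfunP => n; apply: mulrA. Qed.
Fact symfun_mulC : commutative symfun_mul.
Proof. by move=> f g; apply: symfunP => n; apply: mulrC. Qed.
Fact symfun_mul1 : left_id symfun1 symfun_mul.
Proof. by move=> f; apply: symfunP => n; apply: mul1r. Qed.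
Fact symfun_mulDl : left_distributive symfun_mul +%R.
Proof. by move=> f g h; apply: symfunP => n; apply: mulrDl. Qed.
Fact symfun_oner_neq0 : symfun1 != 0.
Proof.
apply/eqP => /(congr1 (fun f : symfun => f 0%N)) /= /eqP.
by rewrite oner_eq0.
Qed.

HB.instance Definition _ := GRing.Zmodule_isComNzRing.Build symfun
  symfun_mulA symfun_mulC symfun_mul1 symfun_mulDl symfun_oner_neq0.

Fact symfun_scaleA c d f :
  symfun_scale c (symfun_scale d f) = symfun_scale (c * d) f.
Proof. by apply: symfunP => n; apply: scalerA. Qed.
Fact symfun_scale1 : left_id 1 symfun_scale.
Proof. by move=> f; apply: symfunP => n; apply: scale1r. Qed.
Fact symfun_scaleDr : right_distributive symfun_scale +%R.
Proof. by move=> c f g; apply: symfunP => n; apply: scalerDr. Qed.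
Fact symfun_scaleDl f : {morph symfun_scale^~ f : c d / c + d}.
Proof. by move=> c d; apply: symfunP => n; apply: scalerDl. Qed.

HB.instance Definition _ := GRing.Zmodule_isLmodule.Build rat symfun
  symfun_scaleA symfun_scale1 symfun_scaleDr symfun_scaleDl.

Fact symfun_scaleAl (c : rat) (f g : symfun) : c *: (f * g) = (c *: f) * g.
Proof. by apply: symfunP => n; apply: scalerAl. Qed.

HB.instance Definition _ :=
  GRing.Lmodule_isLalgebra.Build rat symfun symfun_scaleAl.

Fact symfun_scaleAr (c : rat) (f g : symfun) : c *: (f * g) = f * (c *: g).
Proof. by apply: symfunP => n; apply: scalerAr. Qed.

HB.instance Definition _ :=
  GRing.Lalgebra_isAlgebra.Build rat symfun symfun_scaleAr.

Section InVars.
Variable n : nat.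

Definition to_vars (f : symfun) : {mpoly rat[n]} := f n.

Fact to_vars_is_zmod : zmod_morphism to_vars. Proof. by []. Qed.
Fact to_vars_is_monoid : monoid_morphism to_vars. Proof. by []. Qed.
Fact to_vars_is_scalable : scalable to_vars. Proof. by []. Qed.

HB.instance Definition _ :=
  GRing.isZmodMorphism.Build symfun {mpoly rat[n]} to_vars to_vars_is_zmod.
HB.instance Definition _ :=
  GRing.isMonoidMorphism.Build symfun {mpoly rat[n]} to_vars to_vars_is_monoid.
HB.instance Definition _ :=
  GRing.isScalable.Build rat symfun {mpoly rat[n]} *:%R to_vars
    to_vars_is_scalable.
End InVars.
Arguments to_vars : simpl never.

Lemma msize_prodX n (I : finType) (P : pred I) (k : I -> 'I_n) :
  (msize (\prod_(i | P i) 'X_(k i) : {mpoly rat[n]}) <= #|I|.+1)%N.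
Proof.
rewrite (mprodXE _ (fun i => U_(k i)%MM)) mmeasureX ltnS /= mdeg_sum -sum1_card.
rewrite [leqRHS](bigID P) /= (eq_bigr (fun=> 1%N)) ?leq_addr // => i _.
exact: mdeg1.
Qed.

Lemma is_symfun_mesym (k : nat) : is_symfun (fun n => mesym n rat k).
Proof.
split=> [n|n|] /=; first exact: mesym_sym.
- case: k => [|k]; first by rewrite !mesym0E drop_last1.
  rewrite mesymSS drop_lastD drop_lastM !drop_last_mwiden drop_lastX.
  by rewrite unlift_none mulr0 addr0.
- exists k.+1 => n; rewrite /mesym.
  apply: leq_trans (msize_sum _ _ _) _; apply/bigmax_leqP => h /eqP <-.
  rewrite mprodXE mmeasureX ltnS /= mdeg_sum -sum1_card.
  by apply: leq_sum => i _; rewrite mdeg1.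
Qed.

Definition elementary (k : nat) : symfun := SymFun (is_symfun_mesym k).

Definition e_ (mu : seq nat) : symfun := \prod_(k <- mu) elementary k.

Definition is_partition (mu : seq nat) : bool := sorted geq mu && (0%N \notin mu).

Definition partition_type := {mu : seq nat | is_partition mu}.

Definition e_combination (c : {fsfun partition_type -> rat with 0}) : symfun :=
  \sum_(mu <- finsupp c) c mu *: e_ (val mu).

(* All the coefficients of f in the basis (e_ mu) are nonnegative; the first
   conjunct makes sure that the second one is not vacuous. *)
Definition e_nonneg (f : symfun) : Prop :=
  (exists c, f = e_combination c) /\
  (forall c, f = e_combination c -> forall mu, 0 <= c mu).

Record sgraph := SGraph {
  vertex :> finType;
  adj : rel vertex;
  adj_sym : ssrbool.symmetric adj;
  adj_irrefl : irreflexive adj }.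

Definition proper_coloring (G : sgraph) (C : finType) (kappa : {ffun G -> C}) :=
  [forall u, forall v, adj u v ==> (kappa u != kappa v)].

Lemma proper_coloring_inj (G : sgraph) (C D : finType) (h : C -> D)
    (kappa : {ffun G -> C}) : injective h ->
  proper_coloring [ffun v => h (kappa v)] = proper_coloring kappa.
Proof.
move=> h_inj; apply: eq_forallb => u; apply: eq_forallb => v.
by rewrite !ffunE (inj_eq h_inj).
Qed.

(* The colors are those of the variables x_0, ..., x_(n-1): the other colorings
   by nonnegative integers contribute 0 when x_n = x_(n+1) = ... = 0. *)
Definition chromatic_poly (G : sgraph) (n : nat) : {mpoly rat[n]} :=
  \sum_(kappa : {ffun G -> 'I_n} | proper_coloring kappa)
    \prod_(v : G) 'X_(kappa v).

Lemma is_symfun_chromatic (G : sgraph) : is_symfun (chromatic_poly G).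
Proof.
rewrite /chromatic_poly; split=> [n|n|].
- apply/issymP => s; rewrite raddf_sum /=.
  pose h (s : 'S_n) (kappa : {ffun G -> 'I_n}) := [ffun v => s (kappa v)].
  rewrite [RHS](reindex_onto (h s) (h s^-1%g)) /=; last first.
    by move=> kappa _; apply/ffunP => v; rewrite !ffunE permKV.
  apply: eq_big => [kappa|kappa _].
    rewrite proper_coloring_inj; last exact: perm_inj.
    case: eqP => [|[]]; first by rewrite andbT.
    by apply/ffunP => v; rewrite !ffunE permK.
  rewrite rmorph_prod; apply: eq_bigr => v _.
  by rewrite ffunE [LHS]mmapX mmap1U.
- pose h (kappa : {ffun G -> 'I_n}) := [ffun v => lift ord_max (kappa v)].
  have h_inj : injective h.
    move=> k1 k2 /ffunP k12; apply/ffunP => v.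
    by have := k12 v; rewrite !ffunE => /lift_inj.
  rewrite drop_last_sum (bigID (mem (codom h))) /= [X in _ + X]big1; last first.
    move=> kappa /andP[_ kappaN]; rewrite drop_last_prod.
    have [v kv|kappa_lt] := pickP [pred v | kappa v == ord_max].
      by rewrite (bigD1 v) //= (eqP kv) drop_lastX unlift_none mul0r.
    case/negP: kappaN; have k' v : {j | kappa v = lift ord_max j}.
      case: (unliftP ord_max (kappa v)) => [j ->|kv]; first by exists j.
      by have := kappa_lt v; rewrite /= kv eqxx.
    apply/codomP; exists [ffun v => sval (k' v)]; apply/ffunP => v.
    by rewrite !ffunE; case: (k' v).
  rewrite addr0 (eq_bigl (mem (h @: [set k | proper_coloring k]))).
    rewrite big_imset /=; last by move=> ? ? _ _; apply: h_inj.
    apply: eq_big => [k|k _]; first by rewrite inE.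
    rewrite drop_last_prod; apply: eq_bigr => v _.
    by rewrite drop_lastX ffunE liftK.
  move=> kappa /=; apply/andP/imsetP => [[kP /codomP[k kE]]|[k]].
    exists k => //; rewrite inE; move: kP; rewrite kE.
    by rewrite proper_coloring_inj //; apply: lift_inj.
  rewrite inE => kP ->; split; last exact: codom_f.
  by rewrite proper_coloring_inj //; apply: lift_inj.
- exists #|G|.+1 => n; apply: leq_trans (msize_sum _ _ _) _.
  by apply/bigmax_leqP => kappa _; apply: msize_prodX.
Qed.

Definition chromatic_symfun (G : sgraph) : symfun :=
  SymFun (is_symfun_chromatic G).

Definition e_positive (G : sgraph) : Prop := e_nonneg (chromatic_symfun G).

Section CompleteMultipartite.
Variable la : seq nat.

(* The vertices of the i-th partite set are the pairs (i, j), j < nth 0 la i. *)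
Definition multipartite_vertex :=
  {i : 'I_(size la) & 'I_(nth 0%N la i)}.

Definition multipartite_adj : rel multipartite_vertex :=
  fun u v => tag u != tag v.

Fact multipartite_adj_sym : ssrbool.symmetric multipartite_adj.
Proof. by move=> u v; apply: (congr1 negb); apply: eq_sym. Qed.

Fact multipartite_adj_irrefl : irreflexive multipartite_adj.
Proof. by move=> u; apply/negbF/eqxx. Qed.

Definition complete_multipartite : sgraph :=
  SGraph multipartite_adj_sym multipartite_adj_irrefl.
End CompleteMultipartite.

(* The inequality compares values, as the two ordinal types differ; shifting
   [d] = {1, ..., d} to {0, ..., d - 1} and [2d] alike does not affect it. *)
Definition a_ (d : nat) : nat :=
  #|[set f : {ffun 'I_d -> 'I_(2 * d)} |
      injectiveb f && [forall i, val (f i) != val i]]|.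

(* Main.v *)
Require Import Defs.
From mathcomp Require Import all_boot all_order all_algebra.
From mathcomp Require Import perm finmap mpoly zify ring lra.

Set Implicit Arguments.
Unset Strict Implicit.
Unset Printing Implicit Defensive.

Import Order.TTheory GRing.Theory Num.Theory.
Local Open Scope ring_scope.

(* We compare the coefficients of a monomial x^m on both sides.  Let t_j be the
   number of variables with exponent j in m.  Colouring the parts one by one,
   the left side has coefficient 0 unless all exponents are at most 2, except
   possibly one equal to 3; in that case the coefficient is an explicit
   expression in the factorials of t_1 and t_2.  On the right side, e_p e_q has the coefficient
   binomial(t_1, p - t_2) at m, and multiplying by e_1 sums over the monomials
   m / x_c.

   The two resulting identities follow from
     sum_d (a_d - a_(d-1)) binomial(2m, m+d) = (2m)!/m!  and
     sum_d (2d+1) a_d binomial(2m+1, m+d+1) = (2m+1)!/m!,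
   which are equivalent by Abel summation and are proved by induction on m from
   a_(d+2) = (4d+6) a_(d+1) + a_d.  This recurrence holds because inclusion-
   exclusion writes a_d as the alternating sum of the coefficients
   (d+i)!/(i!(d-i)!) of a Bessel polynomial.

   For e-positivity, the e_mu are linearly independent by the fundamental
   theorem of symmetric polynomials in sufficiently many variables. *)

(** * The numbers [a_ d] *)

(** Induction on the number of points outside [S]. For [x] outside [S], an injection agreeing with
    [h] on [S] takes at [x] one of the [#|M| - #|S|] values outside [h @: S]. All these values are
    equally frequent, and the value [h x] amounts to adding [x] to [S]. *)
Lemma card_inj_ffun_fix (D M : finType) (h : D -> M) (S : {set D}) :
  injective h ->
  #|[set f : {ffun D -> M} | injectiveb f && [forall i in S, f i == h i]]|
  = ((#|M| - #|S|) ^_ (#|D| - #|S|))%N.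
Proof.
move=> h_inj; pose E (T : {set D}) :=
  [set f : {ffun D -> M} | injectiveb f && [forall i in T, f i == h i]].
rewrite -/(E S).
have leDM : (#|D| <= #|M|)%N by rewrite -(card_codom h_inj) max_card.
have [k Sk] : {k | (#|D| - #|S|)%N = k} by exists (#|D| - #|S|)%N.
rewrite Sk; elim: k S Sk => [|k IH] S Sk.
  have ST : S = setT.
    by apply/eqP; rewrite eqEcard subsetT cardsT -subn_eq0 Sk.
  rewrite ffactn0 (_ : E S = [set [ffun i => h i]]) ?cards1 //.
  apply/setP => f; rewrite !inE ST; apply/andP/eqP.
    by move=> [_ /forall_inP fh]; apply/ffunP => i;
      rewrite ffunE (eqP (fh i _)).
  move=> ->; split; last by apply/forall_inP => i _; rewrite ffunE.
  by apply/injectiveP => i j; rewrite !ffunE => /h_inj.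
have [x xS] : {x | x \notin S}.
  case: (pickP [pred x | x \notin S]) => [x|SS]; first by exists x.
  have ST : S = setT by apply/setP => x; have := SS x;
    rewrite !inE => /negbFE->.
  by move: Sk; rewrite ST cardsT subnn.
have card_xS : #|x |: S| = #|S|.+1 by rewrite cardsU1 xS.
(* Composing with the transposition of [h x] and [y], which fixes [h @: S],
   turns the value [y] at [x] into [h x]. *)
have sub_y y : y \notin h @: S -> #|[set f in E S | f x == y]| = #|E (x |: S)|.
  move=> yS; pose t (f : {ffun D -> M}) := [ffun i => tperm (h x) y (f i)].
  have tK : involutive t.
    by move=> f; apply/ffunP => i; rewrite !ffunE tpermK.
  rewrite -(card_imset _ (inv_inj tK)); apply: eq_card => f.
  rewrite -[f in LHS]tK (mem_imset _ _ (inv_inj tK)) !inE.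
  have -> : injectiveb (t f) = injectiveb f.
    apply/injectiveP/injectiveP => inj i j; last first.
      by rewrite !ffunE => /perm_inj/inj.
    by move=> fij; apply: inj; rewrite !ffunE fij.
  rewrite -andbA; congr (_ && _).
  have tS i : i \in S -> (t f i == h i) = (f i == h i).
    move=> iS; rewrite ffunE -{1}[h i](@tpermD _ (h x) y).
    - by rewrite (inj_eq perm_inj).
    - by rewrite (inj_eq h_inj); apply: contraNneq xS => ->.
    - by apply: contraNneq yS => ->; apply: imset_f.
  rewrite ffunE (can2_eq (tpermK _ _) (tpermK _ _)) tpermR.
  apply/andP/forall_inP => [[/forall_inP fS fx] i|fS].
    by rewrite !inE => /predU1P[->//|iS]; rewrite -tS ?fS.
  split; last by apply: fS; rewrite setU11.
  by apply/forall_inP => i iS; rewrite tS ?fS // setU1r.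
have -> : #|E S| = (\sum_(y in ~: (h @: S)) #|[set f in E S | f x == y]|)%N.
  rewrite -sum1_card (partition_big (fun f : {ffun D -> M} => f x)
    (mem (~: (h @: S)))) /=; last first.
    move=> f; rewrite !inE => /andP[/injectiveP f_inj /forall_inP fS].
    apply/negP => /imsetP[i iS fxi]; move: xS; rewrite (f_inj x i) ?iS //.
    by rewrite fxi (eqP (fS i iS)).
  by apply: eq_bigr => y _; rewrite -sum1_card; apply: eq_bigl => f;
    rewrite !inE.
under eq_bigr => y.
  rewrite inE => /sub_y ->; rewrite (IH (x |: S)); last by rewrite card_xS; lia.
  over.
rewrite sum_nat_const cardsCs setCK (card_imset _ h_inj) card_xS ffactnS.
by congr (_ * _ ^_ _)%N; lia.
Qed.

(** The coefficient of x^i in y_d(2x), where y_d is the Bessel polynomial. The value 0 for [i > d]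
    makes the three-term recurrence hold at every index. *)
Definition bessel_coef (d i : nat) : rat :=
  if (i <= d)%N then (d + i)`!%:R / (i`!%:R * (d - i)`!%:R) else 0.

Lemma factn_neq0 (n : nat) : n`!%:R != 0 :> rat.
Proof. by rewrite pnatr_eq0 -lt0n fact_gt0. Qed.

Lemma factSr (n : nat) : n.+1`!%:R = n.+1%:R * n`!%:R :> rat.
Proof. by rewrite factS natrM. Qed.

(** Inclusion-exclusion over the set of points where an injection agrees with the inclusion [h]. The
    sets of size j contribute C(d, j) (2d-j)!/d! up to sign, which is the Bessel coefficient of
    index i = d - j. *)
Lemma a_bessel (d : nat) :
  (a_ d)%:R = \sum_(0 <= i < d.+1) (-1) ^+ (d + i) * bessel_coef d i :> rat.
Proof.
have le_d : (d <= 2 * d)%N by lia.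
pose h : 'I_d -> 'I_(2 * d) := widen_ord le_d.
have h_inj : injective h by move=> i j /(congr1 val) /= /val_inj.
(* Expanding the product over i of 1 - [f i = h i], the indicator of having no forbidden value,
   gives the sum of [F f J] over all [J]. *)
pose F (f : {ffun 'I_d -> 'I_(2 * d)}) (J : {set 'I_d}) : rat :=
  \prod_i (if i \in J then - (f i == h i)%:R else 1).
have -> : (a_ d)%:R = \sum_(f : {ffun 'I_d -> 'I_(2 * d)} | injectiveb f)
    \sum_(J in {set 'I_d}) F f J.
  rewrite /a_ -sum1_card natr_sum.
  under [RHS]eq_bigr => f _ do
    rewrite -(bigA_distr _ _ (fun i => - (f i == h i)%:R)).
  rewrite [RHS](bigID (fun f : {ffun 'I_d -> 'I_(2 * d)} =>
    [forall i, val (f i) != val i])) /= [X in _ = _ + X]big1 ?addr0; last first.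
    move=> f /andP[_ /forallPn[i /negPn fi]]; rewrite (bigD1 i) //=.
    have -> : (f i == h i) by rewrite -val_eqE.
    by rewrite addNr mul0r.
  apply: eq_big => [f|f]; first by rewrite inE.
  rewrite inE => /andP[_ /forallP fi]; rewrite big1 // => i _.
  have := fi i; rewrite -[val i]/(val (h i)) val_eqE => /negPf ->.
  by rewrite oppr0 add0r.
rewrite exchange_big /=.
(* Once the injections are summed out, only the size of [J] matters. *)
pose G (j : nat) : rat := (-1) ^+ j * ((2 * d - j) ^_ (d - j))%:R.
transitivity (\sum_(J in {set 'I_d}) G #|J|).
  apply: eq_bigr => J _; rewrite /G.
  have := card_inj_ffun_fix J h_inj; rewrite !card_ord => <-.
  have FE f : F f J = (-1) ^+ #|J| * [forall i in J, f i == h i]%:R.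
    rewrite /F -big_mkcond /= prodrN; congr (_ * _).
    case: forall_inP => [fJ|fJ]; first by rewrite big1 // => i /fJ ->.
    have /forall_inPn[i iJ /negPf fi] : ~~ [forall i in J, f i == h i].
      by apply/forall_inP.
    by rewrite (bigD1 i) //= fi mul0r.
  under eq_bigr => f _ do rewrite FE.
  rewrite -mulr_sumr; congr (_ * _).
  rewrite -sum1_card natr_sum big_mkcond [in RHS]big_mkcond /=.
  by apply: eq_bigr => f _; rewrite inE; do 2 case: ifP => //=.
rewrite (partition_big (fun J : {set 'I_d} => inord #|J| : 'I_d.+1) predT) //=.
(* Reversing the order of summation matches the Bessel index with [d - j]. *)
rewrite big_nat_rev /= big_mkord; apply: eq_bigr => j _.
have jd : (j <= d)%N by rewrite -ltnS.
rewrite (eq_big (fun J : {set 'I_d} => #|J| == j) (fun=> G j)); first last.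
- move=> J /eqP <-; rewrite inordK // ltnS.
  by rewrite (leq_trans (max_card _)) ?card_ord.
- move=> J; rewrite -val_eqE /= inordK // ltnS.
  by rewrite (leq_trans (max_card _)) ?card_ord.
rewrite sumr_const -cardsE card_draws card_ord -mulr_natl /G add0n subSS.
have bin_eq : ('C(d, j) * (j`! * (d - j)`!))%N = d`! by apply: bin_fact.
have ffact_eq : ((2 * d - j) ^_ (d - j) * d`!)%N = (2 * d - j)`!.
  by rewrite -[in RHS](@ffact_fact (2 * d - j) (d - j)) //;
    [congr (_ * _`!)%N|]; lia.
have -> : (-1) ^+ (d + (d - j)) = (-1) ^+ j :> rat.
  by rewrite -signr_odd; have -> : odd (d + (d - j)) = odd j;
    [lia | rewrite signr_odd].
rewrite /bessel_coef leq_subr (_ : d + (d - j) = 2 * d - j)%N; last by lia.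
rewrite (_ : d - (d - j) = j)%N; last by lia.
rewrite -ffact_eq -bin_eq !natrM.
have := factn_neq0 j; have := factn_neq0 (d - j).
move: (j`!%:R) ((d - j)`!%:R) => x y x0 y0; field.
by rewrite x0 y0.
Qed.

(** This is the recurrence y_(d+2)(2x) = (4d+6) x y_(d+1)(2x) + y_d(2x) of the Bessel polynomials,
    read coefficientwise. *)
Lemma bessel_coefSS (d i : nat) :
  bessel_coef d.+2 i.+1
  = bessel_coef d i.+1 + (4 * d + 6)%:R * bessel_coef d.+1 i.
Proof.
rewrite /bessel_coef !ltnS.
have [/subnKC <-|di] := leqP i d; last first.
  have [->|di'] := eqVneq i d.+1; last first.
    by rewrite !ifF ?mulr0 ?addr0 //; lia.
  rewrite leqnn (_ : d.+1 < d = false)%N; last by lia.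
  rewrite !subnn (_ : d.+2 + d.+2 = (d.+1 + d.+1).+2)%N; last by lia.
  have [e eE] : {e | e = (d.+1 + d.+1)%N} by eexists.
  rewrite -eE.
  rewrite (factSr d.+1) (factSr e.+1) (factSr e) fact0.
  have := factn_neq0 d.+1; move: (e`!%:R) (d.+1`!%:R) => x y y0.
  have -> : e.+2 = (2 * d.+2)%N by lia.
  have -> : (4 * d + 6 = 2 * e.+1)%N by lia.
  rewrite (natrM _ 2 d.+2) (natrM _ 2 e.+1).
  have : d.+2%:R != 0 :> rat by rewrite pnatr_eq0.
  by move: (d.+2%:R) (e.+1%:R) => u v u0; field; rewrite u0 y0.
move: (d - i)%N => k {d}.
rewrite (_ : i <= (i + k).+1)%N; last by lia.
rewrite (_ : (i + k).+2 - i.+1 = k.+1)%N; last by lia.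
rewrite (_ : (i + k).+1 - i = k.+1)%N; last by lia.
(* In this form the factor k absorbs the case distinction: it vanishes exactly when the coefficient
   is out of range. *)
have -> : (if (i < i + k)%N then (i + k + i.+1)`!%:R /
    ((i.+1)`!%:R * (i + k - i.+1)`!%:R) else 0)
  = k%:R * k.+1%:R * (i + k + i.+1)`!%:R / (i.+1`!%:R * k.+1`!%:R) :> rat.
  case: k => [|k]; first by rewrite addn0 ltnn !mul0r.
  rewrite ifT; last by lia.
  rewrite (_ : i + k.+1 - i.+1 = k)%N; last by lia.
  rewrite (factSr k.+1) (factSr k); have := factn_neq0 k;
    have := factn_neq0 i.+1.
  have : k.+1%:R != 0 :> rat by rewrite pnatr_eq0.
  have : k.+2%:R != 0 :> rat by rewrite pnatr_eq0.
  move: (i.+1`!%:R) (k`!%:R) ((_ + _)`!%:R) => x y z.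
  by move: (k.+1%:R) (k.+2%:R) => u v v0 u0 x0 y0; field; rewrite u0 v0 x0 y0.
rewrite (_ : (i + k).+2 + i.+1 = (i + k + i.+1).+2)%N; last by lia.
rewrite (_ : (i + k).+1 + i = i + k + i.+1)%N; last by lia.
have [e eE] : {e | e = (i + k + i.+1)%N} by eexists.
rewrite -eE.
rewrite (factSr i) (factSr k) (factSr e.+1) (factSr e).
have := factn_neq0 k; have := factn_neq0 i.
move: (i`!%:R) (k`!%:R) => x y x0 y0.
(* With e = 2i + k + 1, the arithmetical core is (e+2)(e+1) = k(k+1) + (4(i+k)+6)(i+1). *)
have -> : (e.+2%:R * (e.+1%:R * e`!%:R) : rat)
  = (k%:R * k.+1%:R + (4 * (i + k) + 6)%:R * i.+1%:R) * e`!%:R.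
  by rewrite mulrA; congr (_ * _); rewrite -!natrM -natrD; congr _%:R; nia.
have : k.+1%:R != 0 :> rat by rewrite pnatr_eq0.
have : i.+1%:R != 0 :> rat by rewrite pnatr_eq0.
move: (i.+1%:R) (k.+1%:R) (k%:R) ((_ + 6)%:R) => u v w t u0 v0.
by field; rewrite u0 v0 x0 y0.
Qed.

(** Evaluate the Bessel recurrence with the alternating signs of [a_bessel]. The constant
    coefficients are all 1, so the one of index [d.+2] supplies the one of index [d]. *)
Lemma a_rec (d : nat) :
  (a_ d.+2)%:R = (4 * d + 6)%:R * (a_ d.+1)%:R + (a_ d)%:R :> rat.
Proof.
rewrite !a_bessel.
have bessel0 e : bessel_coef e 0 = 1.
  by rewrite /bessel_coef /= addn0 subn0 fact0 mul1r divff ?factn_neq0.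
rewrite big_nat_recl //= bessel0 addn0 mulr1.
under eq_bigr => i _ do rewrite bessel_coefSS mulrDr.
rewrite big_split /= addrA addrC mulr_sumr; congr (_ + _).
  apply: eq_bigr => i _; rewrite (_ : d.+2 + i.+1 = (d.+1 + i).+2)%N;
    last by lia.
  by rewrite !exprS; ring.
(* The two top terms vanish, their indices [d.+1] and [d.+2] exceeding [d]. *)
rewrite big_nat_recr //= big_nat_recr //= -/(bessel_coef d d.+1).
rewrite {3}/bessel_coef ltnNge leqnSn /= {2}/bessel_coef ltnn !mulr0 !addr0.
rewrite [RHS]big_nat_recl //= bessel0 addn0 mulr1; congr (_ + _).
  by rewrite !exprS; ring.
by apply: eq_bigr => i _; rewrite (_ : d.+2 + i.+1 = (d + i.+1).+2)%N ?exprS;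
  [ring|lia].
Qed.

Lemma a_0 : a_ 0 = 1%N.
Proof. by apply/eqP; rewrite -(eqr_nat rat) a_bessel big_nat1. Qed.

Lemma a_1 : a_ 1 = 1%N.
Proof.
by apply/eqP; rewrite -(eqr_nat rat) a_bessel !big_nat_recr ?big_geq //=.
Qed.

(** * Sums of the numbers [a_ d] against binomial coefficients *)

(** Even rows of Pascal's triangle, indexed by the distance [d] from the centre, so that passing
    from [m] to [m.+1] keeps the centre in place. *)
Definition cbin (m d : nat) : rat := 'C(2 * m, m + d)%:R.

Lemma cbinSS (m d : nat) :
  cbin m.+1 d.+1 = cbin m d + 2 * cbin m d.+1 + cbin m d.+2.
Proof.
rewrite /cbin (_ : 2 * m.+1 = (2 * m).+2)%N; last by lia.
rewrite (_ : m.+1 + d.+1 = (m + d).+2)%N; last by lia.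
by move: (2 * m)%N => k; rewrite !binS !addnS !natrD; ring.
Qed.

(** The rule of [cbinSS] at the centre, where the left neighbour equals the right one by
    symmetry. *)
Lemma cbinS0 (m : nat) : cbin m.+1 0 = 2 * cbin m 0 + 2 * cbin m 1.
Proof.
case: m => [|m]; first by rewrite /cbin /= !bin1 bin0.
rewrite /cbin (_ : 2 * m.+2 = (2 * m.+1).+2)%N; last by lia.
have : 'C(2 * m.+1, m) = 'C(2 * m.+1, m.+2).
  by rewrite -bin_sub; [congr 'C(_, _)|]; lia.
move: (2 * m.+1)%N => k Ck.
rewrite !addn0 addn1 !binS Ck.
by rewrite !natrD; ring.
Qed.

Lemma cbin_eq0 (m d : nat) : (m < d)%N -> cbin m d = 0.
Proof. by move=> md; rewrite /cbin bin_small //; lia. Qed.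

(** A rearrangement of (m+d+1) C(2m, m+d+1) = (m-d) C(2m, m+d). It trades sums of neighbours
    weighted by 2d+1 for plain differences, which closes the induction in [sum_a_cbin]. *)
Lemma cbin_diff (m d : nat) :
  (2 * m + 1)%:R * (cbin m d - cbin m d.+1)
  = (2 * d + 1)%:R * (cbin m d + cbin m d.+1).
Proof.
have : ((m + d.+1) * 'C(2 * m, m + d.+1) = (m - d) * 'C(2 * m, m + d))%N.
  by rewrite addnS mul_bin_left; congr (_ * _)%N; lia.
have [dm|md] := leqP d m; last by rewrite !cbin_eq0 ?subr0 ?addr0 ?mulr0 //;
  lia.
move/(congr1 (fun k : nat => k%:R : rat)); rewrite !natrM natrB // -/(cbin _ _).
rewrite -/(cbin _ _) (natrD _ m) -(natr1 d) (natrD _ (2 * m)) (natrM _ 2 m).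
by rewrite (natrD _ (2 * d)) (natrM _ 2 d); lra.
Qed.

(* Extending by [a_(-1) = -1], the difference of the two summands is
   [R d - R d.+1] with [R d = a_ d * s (d - 1) + a_ (d - 1) * s d],
   [s d = cbin m d + cbin m d.+1]. *)
Lemma sum_a_telescope (m N : nat) :
  \sum_(0 <= d < N.+1) (a_ d)%:R * (cbin m.+1 d - cbin m.+1 d.+1)
  = 2 * \sum_(0 <= d < N.+1)
      (2 * d + 1)%:R * (a_ d)%:R * (cbin m d + cbin m d.+1)
    - ((a_ N.+1)%:R * (cbin m N + cbin m N.+1)
       + (a_ N)%:R * (cbin m N.+1 + cbin m N.+2)).
Proof.
elim: N => [|N IH].
  by rewrite !big_nat1 cbinS0 cbinSS a_0 a_1; ring.
rewrite big_nat_recr //= IH [in RHS]big_nat_recr //= a_rec !cbinSS.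
rewrite (_ : 4 * N + 6 = 2 * (2 * N.+1 + 1))%N; last by lia.
by rewrite (natrM _ 2 (_ + 1)); ring.
Qed.

(** Induction on [m]: the boundary terms of [sum_a_telescope] vanish for large [N], and [cbin_diff]
    turns what is left into 2(2m+1) times the sum for [m], the ratio of consecutive right-hand
    sides. *)
Lemma sum_a_cbin (m N : nat) : (m < N)%N ->
  \sum_(0 <= d < N) (a_ d)%:R * (cbin m d - cbin m d.+1)
  = (2 * m)`!%:R / m`!%:R.
Proof.
elim: m N => [|m IH] N mN.
  case: N mN => // N _; rewrite big_nat_recl // big1 => [|i _].
    by rewrite a_0 /cbin bin0 bin_small //.
  by rewrite !cbin_eq0 // subr0 mulr0.
case: N mN => // N mN; rewrite sum_a_telescope !cbin_eq0; [|lia..].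
rewrite !(addr0, mulr0, subr0).
under eq_bigr => d _ do rewrite mulrAC -cbin_diff -mulrA [_ * (a_ d)%:R]mulrC.
rewrite -mulr_sumr IH; last by lia.
rewrite (_ : 2 * m.+1 = (2 * m).+2)%N; last by lia.
rewrite !factSr (_ : (2 * m).+2 = 2 * m.+1)%N; last by lia.
rewrite natrM addn1; have := factn_neq0 m.
have : m.+1%:R != 0 :> rat by rewrite pnatr_eq0.
by move: (_`!%:R) (_`!%:R) (m.+1%:R) => x y z z0 y0; field; rewrite z0 y0.
Qed.

(** By Pascal's rule C(2m+1, m+d+1) is the sum of two neighbours in row 2m, so [cbin_diff] reduces
    this to [sum_a_cbin]. *)
Lemma sum_a_bin_odd (m N : nat) : (m < N)%N ->
  \sum_(0 <= d < N) (2 * d + 1)%:R * (a_ d)%:R * 'C(2 * m + 1, m + d + 1)%:R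
  = (2 * m + 1)`!%:R / m`!%:R :> rat.
Proof.
move=> mN; rewrite addn1 factSr -[RHS]mulrA -(sum_a_cbin mN) mulr_sumr.
apply: eq_bigr => d _; rewrite mulrCA -(addn1 (2 * m)) cbin_diff mulrA [_ * (a_
  d)%:R]mulrC.
congr (_ * _); rewrite /cbin (addn1 (m + d)) -addnS.
by move: (2 * m)%N => k; rewrite addn1 addnS binS natrD addrC.
Qed.

(** Abel summation of [sum_a_cbin]. The sum starts at 2 because the increment at 1 is zero, [a_ 0]
    and [a_ 1] both being 1. *)
Lemma sum_a_bin_even (m N : nat) : (m < N)%N -> (1 < N)%N ->
  'C(2 * m, m)%:R + \sum_(2 <= d < N)
    ((a_ d)%:R - (a_ d.-1)%:R) * 'C(2 * m, m + d)%:R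
  = (2 * m)`!%:R / m`!%:R :> rat.
Proof.
move=> mN N1; rewrite -(sum_a_cbin mN).
suff H k : \sum_(0 <= d < k.+2) (a_ d)%:R * (cbin m d - cbin m d.+1)
   = cbin m 0 + \sum_(2 <= d < k.+2) ((a_ d)%:R - (a_ d.-1)%:R) * cbin m d
     - (a_ k.+1)%:R * cbin m k.+2.
  case: N N1 mN => [|[|N]] // _ mN; rewrite H.
  have -> : cbin m N.+2 = 0 by apply: cbin_eq0.
  rewrite mulr0.
  by rewrite subr0 /cbin addn0.
elim: k => [|k IH].
  by rewrite big_nat_recl // big_nat1 [in RHS]big_geq // a_0 a_1; ring.
by rewrite big_nat_recr //= IH [in RHS]big_nat_recr //=; ring.
Qed.

(** * Linear independence of the [e_ mu] *)

Section PartitionMonomial.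
Variable n : nat.

(** The exponent vector of [e_ mu] as a monomial in e_1, ..., e_n. *)
Definition partition_mnm (mu : seq nat) : 'X_{1..n} :=
  [multinom count_mem i.+1 mu | i < n].

Lemma partition_mnm_inj (mu nu : seq nat) :
  is_partition mu -> is_partition nu ->
  all (leq^~ n) mu -> all (leq^~ n) nu ->
  partition_mnm mu = partition_mnm nu -> mu = nu.
Proof.
move=> /andP[mu_sorted mu0] /andP[nu_sorted nu0] mu_n nu_n mn.
apply: (sorted_eq _ _ mu_sorted nu_sorted).
- by move=> i j k; rewrite /= => ij ki; apply: leq_trans ki ij.
- by move=> i j /andP[/= ij ji]; apply/eqP; rewrite eqn_leq ij ji.
apply/allP => k _ /=; have [->|k0] := eqVneq k 0%N.
  by rewrite (count_memPn mu0) (count_memPn nu0).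
have [kn|nk] := leqP k n; last first.
  have notin xs : all (leq^~ n) xs -> k \notin xs.
    by move=> /allP xs_n; apply/negP => /xs_n /=; rewrite leqNgt nk.
  by rewrite (count_memPn (notin _ mu_n)) (count_memPn (notin _ nu_n)).
have k1n : (k.-1 < n)%N by lia.
move/mnmP/(_ (Ordinal k1n)): mn; rewrite !mnmE /= prednK ?lt0n // => ->.
exact: eqxx.
Qed.

Lemma in_vars_e (mu : seq nat) : 0%N \notin mu -> all (leq^~ n) mu ->
  in_vars (e_ mu) n
  = 'X_[rat, partition_mnm mu] \mPo [tuple mesym n rat i.+1 | i < n].
Proof.
rewrite -/(to_vars n (e_ mu)) /e_ rmorph_prod comp_mpolyX /=.
elim: mu => [|k mu IH]; first by rewrite big_nil big1 // => i _; rewrite mnmE.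
rewrite in_cons negb_or big_cons /= => /andP[k0 mu0] /andP[kn mu_n].
have k1n : (k.-1 < n)%N by lia.
rewrite IH // (bigD1 (Ordinal k1n)) // [RHS](bigD1 (Ordinal k1n)) //=.
rewrite !mnmE !tnth_mktuple /= prednK ?lt0n 1?eq_sym // eqxx exprS -!mulrA.
congr (_ * (_ * _)); apply: eq_bigr => i ik; rewrite !mnmE /=.
case: eqVneq => // ki; case/negP: ik; apply/eqP/val_inj => /=.
by rewrite ki.
Qed.

End PartitionMonomial.

Lemma e_combinationEw (c : {fsfun partition_type -> rat with 0})
    (S : {fset partition_type}) : (finsupp c `<=` S)%fset ->
  e_combination c = \sum_(mu <- S) c mu *: e_ (val mu).
Proof.
move=> cS; apply: (big_fset_incl _ cS) => mu _ cmu.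
by rewrite (fsfun_dflt cmu) scale0r.
Qed.

(** In sufficiently many variables the difference of the two combinations is a polynomial in e_1,
    ..., e_n, zero by the fundamental theorem. Distinct partitions give distinct monomials, so its
    coefficients can be read off. *)
Lemma e_combination_inj : injective e_combination.
Proof.
move=> c c' cc'; apply/fsfunP => mu.
(* Including [mu] covers the case where it lies in neither support. *)
pose S := (mu |` (finsupp c `|` finsupp c'))%fset.
have eS (d : {fsfun partition_type -> rat with 0}) :
    (finsupp d `<=` (finsupp c `|` finsupp c'))%fset ->
    e_combination d = \sum_(nu <- S) d nu *: e_ (val nu).
  by move=> dS; apply: e_combinationEw; apply: fsubset_trans dS (fsubsetU1 _ _).
move: cc'; rewrite !eS ?fsubsetUl ?fsubsetUr // => /eqP.
rewrite -subr_eq0 -sumrB => /eqP cc'.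
(* No part of a partition in [S] exceeds this number of variables. *)
pose n := (\max_(nu <- S) \max_(k <- val nu) k)%N.
have leS nu : nu \in S -> all (leq^~ n) (val nu).
  move=> nuS; apply/allP => k knu /=; rewrite /n.
  apply: leq_trans (leq_bigmax_seq _ nuS isT).
  exact: (leq_bigmax_seq k knu isT).
have := congr1 (to_vars n) cc'; rewrite raddf_sum raddf0 /=.
under eq_big_seq => nu nuS.
  rewrite -scalerBl linearZ /= /to_vars in_vars_e; last first.
  - exact: leS.
  - by case/andP: (valP nu).
  rewrite -comp_mpolyZ.
  over.
rewrite -raddf_sum => /msym_fundamental_un0/(congr1 (mcoeff (partition_mnm n
  (val mu)))).
have muS : mu \in S by apply: fset1U1.
rewrite mcoeff0 raddf_sum /= (bigD1_seq mu) ?fset_uniq //= big1_seq ?addr0.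
  by rewrite mcoeffZ mcoeffX eqxx mulr1 => /eqP; rewrite subr_eq0 => /eqP.
move=> nu /andP[nu_mu nuS]; rewrite mcoeffZ mcoeffX.
case: eqP => [mn|]; last by rewrite mulr0.
case/eqP: nu_mu; apply: val_inj; apply: (partition_mnm_inj (valP nu) (valP mu))
  mn.
  exact: leS.
exact: leS.
Qed.

(** * Symmetric functions with a nonnegative e-expansion *)

(** One nonnegative expansion suffices by uniqueness, and this form is visibly closed under sums and
    nonnegative multiples. *)
Definition e_nonneg_combination (f : symfun) : Prop :=
  exists c : {fsfun partition_type -> rat with 0},
    (forall mu, 0 <= c mu) /\ f = e_combination c.

Lemma e_nonnegP (f : symfun) : e_nonneg_combination f -> e_nonneg f.
Proof.
by move=> [c [c_ge0 ->]]; split=> [|d /e_combination_inj <-]; first by exists c.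
Qed.

Lemma e_nonneg_combination_e (mu : seq nat) :
  is_partition mu -> e_nonneg_combination (e_ mu).
Proof.
move=> mu_part; pose nu : partition_type := exist _ mu mu_part.
exists [fsfun x in [fset nu]%fset => 1 | 0]; split=> [x|].
  by rewrite fsfunE; case: ifP.
rewrite (@e_combinationEw _ [fset nu]%fset) ?finsupp_sub //.
by rewrite big_seq_fset1 fsfunE inE eqxx scale1r.
Qed.

Lemma e_nonneg_combination0 : e_nonneg_combination 0.
Proof.
exists [fsfun]; split=> [x|]; first by rewrite fsfunE.
by rewrite (@e_combinationEw _ fset0) ?finsupp0 // big_seq_fset0.
Qed.

Lemma e_nonneg_combinationD (f g : symfun) : e_nonneg_combination f ->
  e_nonneg_combination g -> e_nonneg_combination (f + g).
Proof.
move=> [c [c_ge0 ->]] [d [d_ge0 ->]]; pose S := (finsupp c `|` finsupp d)%fset.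
pose h : {fsfun partition_type -> rat with 0} :=
  [fsfun x in S => c x + d x | 0].
have hE x : h x = c x + d x.
  rewrite fsfunE; case: ifPn => //; rewrite inE negb_or => /andP[cx dx].
  by rewrite !fsfun_dflt // addr0.
exists h; split=> [x|]; first by rewrite hE addr_ge0.
rewrite (@e_combinationEw c S) ?fsubsetUl // (@e_combinationEw d S) ?fsubsetUr
  //.
rewrite (@e_combinationEw h S) ?finsupp_sub // -big_split /=.
by apply: eq_bigr => x _; rewrite hE scalerDl.
Qed.

Lemma e_nonneg_combinationZ (k : rat) (f : symfun) : 0 <= k ->
  e_nonneg_combination f -> e_nonneg_combination (k *: f).
Proof.
move=> k_ge0 [c [c_ge0 ->]].
pose h : {fsfun partition_type -> rat with 0} :=
  [fsfun x in finsupp c => k * c x | 0].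
have hE x : h x = k * c x.
  by rewrite fsfunE; case: ifPn => // cx; rewrite !fsfun_dflt // mulr0.
exists h; split=> [x|]; first by rewrite hE mulr_ge0.
rewrite (@e_combinationEw h (finsupp c)) ?finsupp_sub // scaler_sumr.
by apply: eq_bigr => x _; rewrite hE scalerA.
Qed.

Lemma e_nonneg_combination_sum (I : eqType) (r : seq I) (F : I -> symfun) :
  (forall i, i \in r -> e_nonneg_combination (F i)) ->
  e_nonneg_combination (\sum_(i <- r) F i).
Proof.
move=> FP; rewrite big_seq; apply: big_ind => //.
- exact: e_nonneg_combination0.
- exact: e_nonneg_combinationD.
Qed.

(** * Coefficients of products of elementary symmetric polynomials *)

Section Level.
Variable n : nat.
Implicit Types (f g : 'I_n -> nat) (m u : 'X_{1..n}).

Definition level f (j : nat) : {set 'I_n} := [set c | f c == j].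

Definition bounded2 f : bool := [forall c, (f c <= 2)%N].

Lemma sum_level f : bounded2 f ->
  (\sum_c f c)%N = (#|level f 1| + 2 * #|level f 2|)%N.
Proof.
move=> /forallP f2; rewrite -!sum1_card big_distrr /=.
rewrite [X in (X + _)%N]big_mkcond [X in (_ + X)%N]big_mkcond -big_split /=.
apply: eq_bigr => c _; rewrite !inE.
by have := f2 c; case: (f c) => [|[|[|]]].
Qed.

(* The guard [t2 <= p] is needed because [p - t2] is truncated. *)
Definition mesym2_coef (p q t1 t2 : nat) : nat :=
  if (t1 + 2 * t2 == p + q)%N && (t2 <= p)%N then 'C(t1, p - t2) else 0.

Lemma mcoeffMX_sub (P : {mpoly rat[n]}) u m :
  (P * 'X_[u])@_m = if (u <= m)%MM then P@_(m - u)%MM else 0.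
Proof.
case: ifP => [um|um]; first by rewrite -[in LHS](submK um) addmC mcoeffMX.
rewrite mcoeffM big1 // => k /eqP mk; rewrite mcoeffX.
case: eqP => [uk|]; last by rewrite mulr0.
by case/negP: um; rewrite mk -uk lem_addl.
Qed.

Lemma card_subset_between (S T : {set 'I_n}) (p : nat) : [disjoint S & T] ->
  #|[set A : {set 'I_n} | [&& S \subset A, A \subset S :|: T & #|A| == p]]|
  = (if #|S| <= p then 'C(#|T|, p - #|S|) else 0)%N.
Proof.
move=> ST; case: ifP => [Sp|Sp]; last first.
  apply/eqP; rewrite cards_eq0; apply/eqP/setP => A; rewrite !inE.
  apply/negP => /and3P[SA _ /eqP Ap].
  by move: Sp; rewrite -Ap subset_leq_card.
rewrite -cards_draws.
have inj : {in [set B : {set 'I_n} | B \subset T & #|B| == (p - #|S|)%N] &,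
    injective (fun B => S :|: B)}.
  move=> B C; rewrite !inE => /andP[BT _] /andP[CT _] eqSBC.
  have key (X : {set _}) : X \subset T -> (S :|: X) :\: S = X.
    move=> XT; rewrite setDUl setDv set0U; apply/setDidPl.
    by rewrite disjoint_sym (disjointWr XT).
  by rewrite -(key B) // eqSBC key.
rewrite -(card_in_imset inj); apply: eq_card => A; rewrite !inE.
apply/and3P/imsetP => [[SA AST /eqP Ap]|[B]].
  exists (A :\: S); last first.
    by rewrite -[LHS](setID A S) (setIidPr SA).
  rewrite inE subDset AST cardsD (setIidPr SA) Ap eqxx //.
rewrite inE => /andP[BT /eqP Bp] ->; split; first exact: subsetUl.
- exact: setUS.
- rewrite cardsU (_ : S :&: B = set0) ?cards0 ?subn0 ?Bp ?subnKC //.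
  by apply/eqP; rewrite setI_eq0 (disjointWr BT).
Qed.

(** A set [A] records the variables taken from e_p. It must contain every variable of exponent 2,
    and its other [p - t2] elements are chosen among the [t1] variables of exponent 1. *)
Lemma mcoeff_mesym2 p q m :
  (mesym n rat p * mesym n rat q)@_m
  = (if bounded2 m then mesym2_coef p q #|level m 1| #|level m 2| else 0)%:R.
Proof.
rewrite mulrC [X in _ * X]mesymE mulr_sumr raddf_sum /=.
under eq_bigr => A _ do rewrite mcoeffMX_sub mcoeff_mesym.
(* Dividing by the variables in [A] leaves a squarefree monomial of degree [q] exactly under the
   conditions on the right. *)
have key (A : {set 'I_n}) : #|A| = p ->
  (if (mesym1 A <= m)%MM then (mechar q (m - mesym1 A))%:R else 0 : rat)
  = [&& bounded2 m, mdeg m == p + q, level m 2 \subset A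
      & A \subset level m 2 :|: level m 1]%N%:R.
  move=> Ap; case: ifP => [/mnm_lepP Am|Am]; last first.
    case: and4P => // -[_ _ _ Asub]; move/mnm_lepP: Am; case=> c.
    rewrite mnmE; case cA : (c \in A) => //=.
    by move/subsetP/(_ c cA): Asub; rewrite !inE => /orP[] /eqP ->.
  congr (_%:R); congr nat_of_bool; rewrite /mechar.
  have mdeg_eq : mdeg m = (p + mdeg (m - mesym1 A)%MM)%N.
    rewrite -Ap -mdeg_mesym1 -mdegD addmC submK //; exact/mnm_lepP.
  rewrite mdeg_eq eqn_add2l andbCA; congr (_ && _).
  apply/forallP/and3P => [m1|[/forallP m2 S2 Asub] c].
    have m1' c : (m c - (c \in A) <= 1)%N by have := m1 c; rewrite mnmE mnmE.
    split.
    - by apply/forallP => c; have := m1' c; case: (c \in A); lia.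
    - apply/subsetP => c; rewrite inE => /eqP mc; have := m1' c.
      by rewrite mc; case: (c \in A).
    - apply/subsetP => c cA; have := Am c; have := m1' c.
      by rewrite mnmE cA !inE; case: (m c) => [|[|[|]]].
  rewrite !mnmE; have := m2 c; move/subsetP/(_ c): S2; rewrite inE.
  by case: (m c) (c \in A) => [|[|[|]]] // [] // /(_ isT).
under eq_bigr => A /eqP/key -> do over.
rewrite -natr_sum; congr (_%:R); case: ifP => [m2|m2] /=; last first.
  by rewrite big1.
rewrite /mesym2_coef mdegE sum_level //.
case: eqP => //= [_|_]; last by rewrite big1.
rewrite -big_mkcondr sum1_card.
rewrite -(@card_subset_between (level m 2) (level m 1)).
  by apply: eq_card => A; rewrite !inE [RHS]andbA andbC.
rewrite -setI_eq0; apply/eqP/setP => c; rewrite !inE.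
by apply/negP => /andP[/eqP ->].
Qed.

(** * Products with a further factor e_1 *)

Definition single3 f (c0 : 'I_n) : bool :=
  (f c0 == 3) && [forall c, (c != c0) ==> (f c <= 2)%N].

(** Dividing by one variable either moves it from exponent 2 to exponent 1 ([t2] choices) or drops
    an exponent 1 ([t1] choices). A truncated predecessor of 0 is harmless, since its factor is
    0. *)
Definition mesym21_coef (p q t1 t2 : nat) : nat :=
  t2 * mesym2_coef p q t1.+1 t2.-1 + t1 * mesym2_coef p q t1.-1 t2.

Lemma mnm_subU m c d : (m - U_(c))%MM d = (m d - (c == d))%N.
Proof. by rewrite mnmBE mnmE. Qed.

Lemma mcoeff_mul_mesym1 (P : {mpoly rat[n]}) m :
  (P * mesym n rat 1)@_m = \sum_(c | (0 < m c)%N) P@_(m - U_(c))%MM.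
Proof.
rewrite mesym1E mulr_sumr raddf_sum [RHS]big_mkcond /=; apply: eq_bigr => c _.
by rewrite mcoeffMX_sub lep1mP lt0n.
Qed.

Lemma level1_subU m c : m c = 1%N ->
  level (m - U_(c))%MM 1 = level m 1 :\ c /\ level (m - U_(c))%MM 2 = level m 2.
Proof.
move=> mc; split; apply/setP => d; rewrite !inE mnm_subU [c == d]eq_sym.
  by case: (eqVneq d c) => [->|_]; rewrite ?mc ?subn0.
by case: (eqVneq d c) => [->|_]; rewrite ?mc ?subn0.
Qed.

Lemma level2_subU m c : m c = 2%N ->
  level (m - U_(c))%MM 1 = c |: level m 1
  /\ level (m - U_(c))%MM 2 = level m 2 :\ c.
Proof.
move=> mc; split; apply/setP => d; rewrite !inE mnm_subU [c == d]eq_sym.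
  by case: (eqVneq d c) => [->|_]; rewrite ?mc ?subn0.
by case: (eqVneq d c) => [->|_]; rewrite ?mc ?subn0.
Qed.

Lemma level3_subU m c : m c = 3%N ->
  level (m - U_(c))%MM 1 = level m 1 /\ level (m - U_(c))%MM 2 = c |: level m 2.
Proof.
move=> mc; split; apply/setP => d; rewrite !inE mnm_subU [c == d]eq_sym.
  by case: (eqVneq d c) => [->|_]; rewrite ?mc ?subn0.
by case: (eqVneq d c) => [->|_]; rewrite ?mc ?subn0.
Qed.

Lemma mcoeff_mesym21_bounded2 p q m : bounded2 m ->
  (mesym n rat p * mesym n rat q * mesym n rat 1)@_m
  = (mesym21_coef p q #|level m 1| #|level m 2|)%:R.
Proof.
move=> /forallP m2; rewrite mcoeff_mul_mesym1.
have sub2 c : bounded2 (m - U_(c))%MM.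
  by apply/forallP => d; rewrite mnm_subU (leq_trans (leq_subr _ _)).
under eq_bigr => c _ do rewrite mcoeff_mesym2 sub2.
rewrite -natr_sum (bigID (mem (level m 2))) /=; congr (_%:R); congr addn.
  rewrite (eq_big (mem (level m 2))
    (fun=> mesym2_coef p q #|level m 1|.+1 #|level m 2|.-1)).
  - by rewrite sum_nat_const.
  - by move=> c; rewrite /= !inE; case: (m c) => [|[|[|]]].
  move=> c /andP[_]; rewrite inE => /eqP mc; have [-> ->] := level2_subU mc.
  by rewrite cardsU1 inE mc /= (cardsD1 c (level m 2)) inE mc.
rewrite (eq_big (mem (level m 1))
  (fun=> mesym2_coef p q #|level m 1|.-1 #|level m 2|)).
- by rewrite sum_nat_const.
- by move=> c; rewrite /= !inE; have := m2 c; case: (m c) => [|[|[|]]].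
move=> c; rewrite inE => /andP[mc_gt0 mc2]; have mc : m c = 1%N.
  by move: mc_gt0 mc2 (m2 c); case: (m c) => [|[|[|]]].
have [-> ->] := level1_subU mc.
by rewrite (cardsD1 c (level m 1)) inE mc.
Qed.

(** The factor e_1 has to lower the exponent 3; then [c0] joins the variables of exponent 2. *)
Lemma mcoeff_mesym21_single3 p q m c0 : single3 m c0 ->
  (mesym n rat p * mesym n rat q * mesym n rat 1)@_m
  = (mesym2_coef p q #|level m 1| #|level m 2|.+1)%:R.
Proof.
move=> /andP[/eqP mc0 /forall_inP m2]; rewrite mcoeff_mul_mesym1.
rewrite (bigD1 c0) ?mc0 //= big1 ?addr0 => [|c /andP[_ cc0]].
  rewrite mcoeff_mesym2; have [-> ->] := level3_subU mc0.
  rewrite cardsU1 inE mc0 /= (_ : bounded2 _) //.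
  apply/forallP => d; rewrite mnm_subU; case: eqVneq => [<-|c0d].
    by rewrite mc0.
  by rewrite subn0 m2 // eq_sym.
rewrite mcoeff_mesym2 ifN //; apply/forallPn; exists c0.
by rewrite mnm_subU mc0 (negPf cc0).
Qed.

Lemma mcoeff_mesym21_eq0 p q m :
  ~~ bounded2 m -> (forall c0, ~~ single3 m c0) ->
  (mesym n rat p * mesym n rat q * mesym n rat 1)@_m = 0.
Proof.
move=> m2 m3; rewrite mcoeff_mul_mesym1 big1 // => c mc.
rewrite mcoeff_mesym2; case: ifP => // /forallP sub2.
have le2 d : d != c -> (m d <= 2)%N.
  by move=> dc; have := sub2 d; rewrite mnm_subU eq_sym (negPf dc) subn0.
case/negP: (m3 c); apply/andP; split; last by apply/forall_inP.
have : (m c <= 3)%N by have := sub2 c; rewrite mnm_subU eqxx leq_subLR.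
rewrite leq_eqVlt => /orP[//|mc2].
case/forallPn: m2 => d; have [->|/le2 -> //] := eqVneq d c.
by rewrite -ltnS mc2.
Qed.

End Level.

(** * Counting colorings *)

Section Colorings.
Variable n : nat.
Implicit Types (f : 'I_n -> nat) (G : sgraph) (m : 'X_{1..n}).

(** Here [f] prescribes how often each colour is used; it is a plain function because colours will
    be erased from it. *)
Definition num_colorings G f : nat :=
  \sum_(kappa : {ffun G -> 'I_n} | proper_coloring kappa
      && [forall c, (\sum_v (kappa v == c))%N == f c]) 1.

Lemma eq_num_colorings G f f' : f =1 f' ->
  num_colorings G f = num_colorings G f'.
Proof.
move=> ff'; apply: eq_bigl => kappa; congr (_ && _).
by apply: eq_forallb => c; rewrite ff'.
Qed.

Lemma mcoeff_chromatic G m :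
  (chromatic_poly G n)@_m = (num_colorings G m)%:R.
Proof.
rewrite /chromatic_poly raddf_sum natr_sum big_mkcondr /=.
apply: eq_bigr => kappa _; rewrite (mprodXE _ (fun v => U_(kappa v)%MM))
  mcoeffX.
set u := (\sum_v _)%MM; have uE c : u c = (\sum_v (kappa v == c))%N.
  by rewrite /u mnm_sumE; apply: eq_bigr => v _; rewrite mnmE.
rewrite (_ : (u == m) = [forall c, (\sum_v (kappa v == c))%N == m c]).
  by case: ifP.
apply/eqP/forallP => [<- c|um]; first by rewrite uE.
by apply/mnmP => c; rewrite uE (eqP (um c)).
Qed.

(** The map [h] presents [G] as the join of an independent set [T] with [G']. No colour occurs on
    both sides, so a colour used on [T] has its full multiplicity there and is forbidden on [G']. *)
Lemma num_colorings_join (T : finType) G G' (h : T + G' -> G) f :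
  bijective h ->
  (forall i j, adj (h (inl i)) (h (inl j)) = false) ->
  (forall i v, adj (h (inl i)) (h (inr v))) ->
  (forall u v, adj (h (inr u)) (h (inr v)) = adj u v) ->
  num_colorings G f
  = (\sum_(g : {ffun T -> 'I_n}
         | [forall i, (\sum_j (g j == g i))%N == f (g i)])
       num_colorings G' (fun c => if [exists i, g i == c] then 0 else f c))%N.
Proof.
move=> h_bij adjTT adjTG adjGG; have [h' hK h'K] := h_bij.
pose glue (p : {ffun T -> 'I_n} * {ffun G' -> 'I_n}) : {ffun G -> 'I_n} :=
  [ffun x => match h' x with inl i => p.1 i | inr v => p.2 v end].
pose cut (kappa : {ffun G -> 'I_n}) :=
  ([ffun i => kappa (h (inl i))], [ffun v => kappa (h (inr v))]).
have glueK : cancel glue cut.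
  move=> [g kappa]; congr (_, _); apply/ffunP => x; rewrite !ffunE hK //.
have cutK : cancel cut glue.
  by move=> kappa; apply/ffunP => x; rewrite ffunE -{2}[x]h'K;
     case: (h' x) => y; rewrite ffunE.
rewrite /num_colorings (reindex glue) /=; last first.
  by apply: onW_bij; exists cut.
rewrite pair_big_dep /=; apply: eq_bigl => -[g kappa] /=.
have glueT i : glue (g, kappa) (h (inl i)) = g i by rewrite ffunE hK.
have glueG v : glue (g, kappa) (h (inr v)) = kappa v by rewrite ffunE hK.
have sum_glue c : (\sum_x (glue (g, kappa) x == c)
    = \sum_i (g i == c) + \sum_v (kappa v == c))%N.
  rewrite (reindex h) ?big_sumType /=; last exact: onW_bij.
  by congr addn; apply: eq_bigr => x _; rewrite ?glueT ?glueG.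
have sum0 (I : finType) (k : {ffun I -> 'I_n}) c :
    ((\sum_i (k i == c))%N == 0) = ~~ [exists i, k i == c].
  rewrite sum_nat_eq0 negb_exists; apply: eq_forallb => i /=.
  by rewrite eqb0.
apply/andP/and3P => [[/forallP proper /forallP cnt]|].
  have disj i v : g i != kappa v.
    by have /forallP/(_ (h (inr v))) := proper (h (inl i));
      rewrite adjTG glueT glueG.
  have kappa0 i : (\sum_v (kappa v == g i))%N = 0%N.
    apply/eqP; rewrite sum0; apply/existsPn => v.
    by rewrite eq_sym.
  split.
  - apply/forallP => i; have := cnt (g i).
    by rewrite sum_glue kappa0 addn0.
  - apply/forallP => u; apply/forallP => v; apply/implyP => uv.
    have /forallP/(_ (h (inr v))) := proper (h (inr u)).
    by rewrite adjGG uv !glueG.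
  apply/forallP => c; case: ifPn => [/existsP[i /eqP <-]|];
    first by rewrite kappa0.
  by rewrite -sum0 => /eqP g0; have := cnt c; rewrite sum_glue g0.
case=> /forallP cntT /forallP proper /forallP cntG.
have disj i v : g i != kappa v.
  have := cntG (g i); rewrite ifT; last by apply/existsP; exists i.
  by rewrite sum0 => /existsPn/(_ v); rewrite eq_sym.
split.
  apply/forallP => x; apply/forallP => y; rewrite -[x]h'K -[y]h'K.
  case: (h' x) (h' y) => [i|u] [j|v]; rewrite ?adjTT ?adjTG ?adjGG ?glueT
    ?glueG //=.
  - by rewrite eq_sym disj implybT.
  - exact: (forallP (proper u) v).
apply/forallP => c; rewrite sum_glue; have := cntG c.
case: ifPn => [/existsP[i /eqP <-]|]; first by move=> /eqP ->; rewrite addn0.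
by rewrite -sum0 => /eqP ->.
Qed.

End Colorings.

(** * Peeling one partite set off a complete multipartite graph *)

Section Cons.
Variables (l : nat) (la : seq nat).

Definition cons_vertex (x : 'I_l + complete_multipartite la) :
    complete_multipartite (l :: la) :=
  match x with
  | inl i => existT (fun i : 'I_(size (l :: la)) => 'I_(nth 0%N (l :: la) i))
    ord0 i
  | inr v => existT (fun i : 'I_(size (l :: la)) => 'I_(nth 0%N (l :: la) i))
               (lift ord0 (tag v)) (tagged v)
  end.

Lemma cons_vertex_bij : bijective cons_vertex.
Proof.
have surj y : {x | cons_vertex x = y}.
  case: y => i; have [j ->|->] := unliftP ord0 i => y.
    by exists (inr (existT (fun i : 'I_(size la) => 'I_(nth 0%N la i)) j y)).
  by exists (inl y).
pose inv y := sval (surj y).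
have invK : cancel inv cons_vertex by move=> y; apply: svalP (surj y).
have inj : injective cons_vertex.
  move=> [i|u] [j|v] //= uv.
    by congr inl; apply: eq_from_Tagged uv.
  congr inr; case: u v uv => iu ju [iv jv] /= uv.
  have /lift_inj eq_i := congr1 tag uv.
  by case: _ / eq_i jv uv => jv uv; congr existT; apply: eq_from_Tagged uv.
by exists inv => // x; apply: inj; rewrite invK.
Qed.

Lemma num_colorings_cons (n : nat) (f : 'I_n -> nat) :
  num_colorings (complete_multipartite (l :: la)) f
  = (\sum_(g : {ffun 'I_l -> 'I_n}
         | [forall i, (\sum_j (g j == g i))%N == f (g i)])
       num_colorings (complete_multipartite la)
         (fun c => if [exists i, g i == c] then 0 else f c))%N.
Proof.
by apply: (num_colorings_join f cons_vertex_bij).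
Qed.

End Cons.

Lemma forall_ordS l (P : pred 'I_l.+1) :
  [forall i, P i] = P ord0 && [forall i, P (lift ord0 i)].
Proof.
apply/forallP/andP => [Pi|[P0 /forallP Pi] i]; first by split=> //;
  apply/forallP.
by case: (unliftP ord0 i) => [j|] ->.
Qed.

Lemma forall_ord0 (P : pred 'I_0) : [forall i, P i].
Proof. by apply/forallP; case. Qed.

Section FfunCons.
Variable C : finType.

Definition ffun_cons (l : nat) (c : C) (g : {ffun 'I_l -> C}) :
    {ffun 'I_l.+1 -> C} :=
  [ffun i => if unlift ord0 i is Some j then g j else c].

Lemma ffun_cons0 l c (g : {ffun 'I_l -> C}) : ffun_cons c g ord0 = c.
Proof. by rewrite ffunE unlift_none. Qed.

Lemma ffun_consS l c (g : {ffun 'I_l -> C}) i :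
  ffun_cons c g (lift ord0 i) = g i.
Proof. by rewrite ffunE liftK. Qed.

Lemma sum_ffun_cons l (F : {ffun 'I_l.+1 -> C} -> nat) :
  (\sum_g F g = \sum_c \sum_(g : {ffun 'I_l -> C}) F (ffun_cons c g))%N.
Proof.
rewrite pair_big /= (reindex (fun p => ffun_cons p.1 p.2)) //.
exists (fun g : {ffun 'I_l.+1 -> C} => (g ord0, [ffun i => g (lift ord0 i)])).
  move=> [c g] _; rewrite /= ffun_cons0; congr (_, _).
  by apply/ffunP => i; rewrite ffunE ffun_consS.
move=> g _; apply/ffunP => i; case: (unliftP ord0 i) => [j|] ->.
  by rewrite ffun_consS ffunE.
by rewrite ffun_cons0.
Qed.

Lemma sum_ffun0 (F : {ffun 'I_0 -> C} -> nat) (g : {ffun 'I_0 -> C}) :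
  (\sum_g F g = F g)%N.
Proof.
by rewrite (big_pred1 g) // => g'; apply/esym/eqP/ffunP => -[].
Qed.

End FfunCons.

(** * Partite sets of sizes 2 and 3 *)

Section TwoThree.
Variable n : nat.
Implicit Types (f : 'I_n -> nat) (c d e : 'I_n) (la : seq nat).

Definition erase f (s : seq 'I_n) c : nat := if c \in s then 0 else f c.

Definition num_erase la f s : nat :=
  num_colorings (complete_multipartite la) (erase f s).

Lemma eq_num_erase la f s s' : s =i s' -> num_erase la f s = num_erase la f s'.
Proof. by move=> ss'; apply: eq_num_colorings => c; rewrite /erase ss'. Qed.

Lemma sum_eq_muln (F : 'I_n -> nat) c : (\sum_d (d == c) * F d = F c)%N.
Proof.
by rewrite (bigD1 c) //= eqxx mul1n big1 ?addn0 // => d /negPf ->.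
Qed.

Lemma num_colorings_cons_mul l la f :
  num_colorings (complete_multipartite (l :: la)) f
  = (\sum_(g : {ffun 'I_l -> 'I_n})
       [forall i, (\sum_j (g j == g i))%N == f (g i)] *
       num_erase la f (codom g))%N.
Proof.
rewrite num_colorings_cons big_mkcond; apply: eq_bigr => g _ /=.
case: ifP => _; rewrite ?mul0n // mul1n; apply: eq_num_colorings => c.
rewrite /erase; congr (if _ then _ else _).
apply/existsP/codomP => [[i /eqP <-]|[i ->]]; first by exists i.
by exists i; rewrite eqxx.
Qed.

(** A colour on the first partite set is used up there. So the set has one colour of multiplicity 2,
    or an ordered pair of distinct colours of multiplicity 1. *)
Lemma num_colorings_cons2 la f :
  num_colorings (complete_multipartite (2 :: la)) f
  = (\sum_c (f c == 2) * num_erase la f [:: c]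
     + \sum_c \sum_d ([&& d != c, f c == 1 & f d == 1]
         * num_erase la f [:: c; d]))%N.
Proof.
have [g0 _] : {g : {ffun 'I_0 -> 'I_n} | true}.
  by eexists; [exact: [ffun i : 'I_0 => widen_ord (leq0n n) i] |].
rewrite num_colorings_cons_mul sum_ffun_cons -big_split /=.
apply: eq_bigr => c _; rewrite sum_ffun_cons.
(* The diagonal sum becomes a double sum with a Kronecker delta, to be compared term by term. *)
rewrite -(sum_eq_muln (fun d => (f d == 2) * num_erase la f [:: d])%N c).
rewrite -big_split /=; apply: eq_bigr => d _; rewrite (sum_ffun0 _ g0).
rewrite !forall_ordS forall_ord0 !big_ord_recl !big_ord0.
rewrite !(ffun_cons0, ffun_consS).
have -> : num_erase la f (codom (ffun_cons c (ffun_cons d g0)))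
    = num_erase la f [:: c; d].
  apply: eq_num_erase => x; rewrite codomE enum_ordSl /= ffun_cons0.
  by rewrite enum_ordSl /= ffun_consS ffun_cons0 enum_ord0.
rewrite !eqxx [c == d]eq_sym; case: (eqVneq d c) => [->|dc] /=.
  rewrite andbT andbb mul0n !addn0 mul1n [_ == f c]eq_sym.
  by congr (_ * _)%N; apply: eq_num_erase => x; rewrite !inE orbb.
by rewrite mul0n !addn0 !add0n andbT [_ == f c]eq_sym [_ == f d]eq_sym.
Qed.

(** The three vertices carry one, two or three colours; the factor 3 is the choice of the vertex
    that differs from the other two. *)
Lemma num_colorings_cons3 la f :
  num_colorings (complete_multipartite (3 :: la)) f
  = (\sum_c (f c == 3) * num_erase la f [:: c]
     + 3 * (\sum_c \sum_d (f c == 2) * ((f d == 1) * num_erase la f [:: c; d]))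
     + \sum_c \sum_d \sum_e
        ([&& d != c, e != c, e != d, f c == 1, f d == 1 & f e == 1]
         * num_erase la f [:: c; d; e]))%N.
Proof.
have [g0 _] : {g : {ffun 'I_0 -> 'I_n} | true}.
  by eexists; [exact: [ffun i : 'I_0 => widen_ord (leq0n n) i] |].
pose X2 c d := ((f c == 2) * ((f d == 1) * num_erase la f [:: c; d]))%N.
(* Multiplicities 2 and 1 force the two colours to differ. *)
have X2E c d : X2 c d = ([&& f c == 2, f d == 1 & d != c]
    * num_erase la f [:: c; d])%N.
  rewrite /X2 mulnA mulnb; congr (nat_of_bool _ * _)%N.
  by case: (eqVneq d c) => [->|_]; rewrite ?andbT //; case: (f c) => [|[|[|]]].
(* The five equality patterns of three colours, the coincidences being encoded by Kronecker
   deltas. *)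
transitivity (\sum_c \sum_d \sum_e
  ((d == c) * ((e == c) * ((f c == 3) * num_erase la f [:: c]))
   + ((d == c) * X2 c e + ((e == c) * X2 c d + (e == d) * X2 d c))
   + [&& d != c, e != c, e != d, f c == 1, f d == 1 & f e == 1]
         * num_erase la f [:: c; d; e]))%N.
  rewrite num_colorings_cons_mul sum_ffun_cons.
  apply: eq_bigr => c _; rewrite sum_ffun_cons; apply: eq_bigr => d _.
  rewrite sum_ffun_cons; apply: eq_bigr => e _; rewrite (sum_ffun0 _ g0).
  rewrite !forall_ordS forall_ord0 !big_ord_recl !big_ord0.
  rewrite !(ffun_cons0, ffun_consS).
  have -> : num_erase la f (codom (ffun_cons c (ffun_cons d (ffun_cons e g0))))
      = num_erase la f [:: c; d; e].
    apply: eq_num_erase => x; rewrite codomE enum_ordSl /= ffun_cons0.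
    rewrite enum_ordSl /= ffun_consS ffun_cons0.
    by rewrite enum_ordSl /= !ffun_consS ffun_cons0 enum_ord0.
  rewrite !X2E !eqxx [c == d]eq_sym [c == e]eq_sym [d == e]eq_sym.
  case: (eqVneq d c) => [->|dc] /=; case: (eqVneq e c) => [->|ec] /=;
    rewrite ?eqxx /= ?(negPf dc) ?(negPf ec) ?andbF ?mul0n ?mul1n ?addn0 ?add0n.
  - rewrite [3 == _]eq_sym !andbT !andbb; congr (_ * _)%N.
    by apply: eq_num_erase => x; rewrite !inE !orbb.
  - rewrite [2 == _]eq_sym [1 == _]eq_sym !andbT andbA andbb.
    by congr (_ * _)%N; apply: eq_num_erase => x; rewrite !inE orbA orbb.
  - have cd : (c == d) = false by rewrite eq_sym (negPf dc).
    rewrite cd /= mul0n !addn0 [2 == f c]eq_sym [1 == f d]eq_sym !andbT.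
    rewrite (_ : [&& _, _ & _] = (f c == 2%N) && (f d == 1%N)); last first.
      by case: (f c == 2); rewrite ?andbF ?andbT.
    congr (_ * _)%N; apply: eq_num_erase => x; rewrite !inE.
    by case: (x == c); rewrite ?orbT ?orbF.
  case: (eqVneq e d) => [->|ed] /=.
    rewrite mul0n mul1n !addn0 !andbT.
    rewrite [1%N == f c]eq_sym ![_ == f d]eq_sym andbb andbC.
    by congr (_ * _)%N; apply: eq_num_erase => x; rewrite !inE orbb orbC.
  by rewrite mul0n !addn0 !add0n andbT [_ == f c]eq_sym [_ == f d]eq_sym [_ ==
    f e]eq_sym.
under eq_bigr => c _.
  under eq_bigr => d _ do rewrite !big_split /=.
  rewrite !big_split /=.
  over.
rewrite !big_split /=; congr (_ + _ + _)%N.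
  apply: eq_bigr => c _; under eq_bigr => d _ do rewrite -big_distrr /=.
  by rewrite sum_eq_muln (sum_eq_muln (fun=> _)).
rewrite !mulSn mul0n addn0; congr (_ + (_ + _))%N.
- apply: eq_bigr => c _; under eq_bigr => d _ do rewrite -big_distrr /=.
  by rewrite (sum_eq_muln (fun=> _)).
- apply: eq_bigr => c _; apply: eq_bigr => d _.
  by rewrite (sum_eq_muln (fun=> _)).
- rewrite exchange_big; apply: eq_bigr => d _; apply: eq_bigr => c _.
  by rewrite (sum_eq_muln (fun=> _)).
Qed.


Lemma sum_mem_muln (S : {set 'I_n}) k : (\sum_c (c \in S) * k = #|S| * k)%N.
Proof. by rewrite -big_distrl /= -sum1_card [in RHS]big_mkcond. Qed.

Lemma sum_mem_cardD1 (S : {set 'I_n}) k :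
  (\sum_c (c \in S) * (#|S :\ c| * k) = #|S| * (#|S|.-1 * k))%N.
Proof.
rewrite -sum_mem_muln; apply: eq_bigr => c _.
by case cS : (c \in S) => //; rewrite (cardsD1 c S) cS.
Qed.

Lemma card_level_erase_cons f c s j : (0 < j)%N ->
  #|level (erase f (c :: s)) j|
  = (#|level (erase f s) j| - ((c \notin s) && (f c == j)))%N.
Proof.
move=> j0; rewrite (cardsD1 c (level (erase f s) j)) inE {2}/erase.
have -> : ((if c \in s then 0 else f c) == j)%N = (c \notin s) && (f c == j).
  by case: (c \in s); rewrite //= eq_sym -leqn0 leqNgt j0.
rewrite addKn; apply: eq_card => d; rewrite !inE /erase inE.
by case: (d == c); rewrite //= eq_sym -leqn0 leqNgt j0.
Qed.

Lemma bounded2_erase f s : all (fun c => (f c <= 2)%N) s ->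
  bounded2 (erase f s) = bounded2 f.
Proof.
move=> /allP s2; apply: eq_forallb => c; rewrite /erase.
by case: ifP => // /s2 ->.
Qed.

(** With t1 = 2j there are b!/j! ways to give each colour of multiplicity 2 its own pair, and (2j)!
    ways to put the other colours on the remaining vertices; [t1 ^_ t1./2] is (2j)!/j!. *)
Definition pairs_coef (b t1 t2 : nat) : nat :=
  if (t1 + 2 * t2 == 2 * b)%N then (b`! * t1 ^_ t1./2)%N else 0.

Lemma pairs_coefE b j t2 : (2 * j + 2 * t2 = 2 * b)%N ->
  pairs_coef b (2 * j) t2 = (b`! * (2 * j) ^_ j)%N.
Proof. by rewrite /pairs_coef mul2n doubleK => ->; rewrite eqxx. Qed.

Lemma pairs_coef_pred2 b j t2 : (2 * j + 2 * t2 = 2 * b.+1)%N ->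
  (t2 * pairs_coef b (2 * j) t2.-1 = t2 * (b`! * (2 * j) ^_ j))%N.
Proof.
by case: t2 => [|t2] E; rewrite ?mul0n // pairs_coefE //=; lia.
Qed.

(** In factorials, 2j (2j-1) (2j-2)!/(j-1)! = j (2j)!/j!. *)
Lemma pairs_coef_pred11 b j t2 : (2 * j + 2 * t2 = 2 * b.+1)%N ->
  (2 * j * ((2 * j).-1 * pairs_coef b (2 * j).-2 t2)
   = j * (b`! * (2 * j) ^_ j))%N.
Proof.
case: j => [|j] E; first by rewrite muln0 !mul0n.
rewrite (_ : 2 * j.+1 = (2 * j).+2)%N /=; last by lia.
rewrite pairs_coefE; last by lia.
apply/eqP; rewrite -(@eqn_pmul2r j`!) ?fact_gt0 //; apply/eqP.
have E1 : ((2 * j) ^_ j * j`! = (2 * j)`!)%N.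
  by rewrite -[in RHS](@ffact_fact (2 * j) j); [congr (_ * _`!)%N|]; lia.
have E2 : ((2 * j).+2 ^_ j.+1 * (j.+1 * j`!)
    = (2 * j).+2 * ((2 * j).+1 * (2 * j)`!))%N.
  rewrite -!factS -[in RHS](@ffact_fact (2 * j).+2 j.+1); last by lia.
  by congr (_ * _`!)%N; lia.
transitivity (b`! * ((2 * j).+2 ^_ j.+1 * (j.+1 * j`!)))%N; last by ring.
by rewrite E2 -E1; ring.
Qed.

Lemma pairs_coef_neq b t1 t2 : (t1 + 2 * t2 != 2 * b)%N -> pairs_coef b t1 t2 =
  0%N.
Proof. by rewrite /pairs_coef => /negPf ->. Qed.

(** Both summands are multiples of b! (2j)!/j!, with factors [t2] and j that add up to b+1. *)
Lemma pairs_coefS b t1 t2 :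
  (t2 * pairs_coef b t1 t2.-1 + t1 * (t1.-1 * pairs_coef b t1.-2 t2)
   = pairs_coef b.+1 t1 t2)%N.
Proof.
have [E|NE] := eqVneq (t1 + 2 * t2)%N (2 * b.+1)%N; last first.
  rewrite [RHS]pairs_coef_neq //; apply/eqP; rewrite addn_eq0.
  apply/andP; split; apply/eqP.
    by case: t2 NE => // t2 NE; rewrite pairs_coef_neq ?muln0 //=; lia.
  by case: t1 NE => [|[|t1]] // NE; rewrite pairs_coef_neq ?muln0 //=; lia.
have [j t1E] : {j | t1 = (2 * j)%N} by exists (b.+1 - t2)%N; lia.
rewrite {}t1E in E *; rewrite pairs_coef_pred2 // pairs_coef_pred11 //.
rewrite pairs_coefE // factS -mulnDl mulnA.
by congr (_ * _ * _)%N; lia.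
Qed.

Lemma num_colorings_nil f :
  num_colorings (complete_multipartite [::]) f = [forall c, f c == 0%N].
Proof.
have empty (v : complete_multipartite [::]) : False by case: v => -[].
have sum0 (k : complete_multipartite [::] -> nat) : (\sum_v k v = 0)%N.
  by apply: big1 => v; case: (empty v).
pose kappa0 : {ffun complete_multipartite [::] -> 'I_n} :=
  [ffun v => False_rect _ (empty v)].
have all_kappa0 kappa : kappa = kappa0 by apply/ffunP => v; case: (empty v).
rewrite /num_colorings big_mkcond (big_pred1 kappa0) => [|kappa]; last first.
  by rewrite (all_kappa0 kappa) /= eqxx.
rewrite (_ : proper_coloring kappa0) /=; last first.
  by apply/forallP => v; case: (empty v).
under eq_forallb => c do rewrite sum0 eq_sym.
by case: ifP.
Qed.

(** Removing one pair yields the recurrence [pairs_coefS]. A multiplicity above 2 cannot be spent on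
    a pair, so it survives to the empty graph and forces the count 0. *)
Lemma num_colorings_pairs b f :
  num_colorings (complete_multipartite (nseq b 2%N)) f
  = if bounded2 f then pairs_coef b #|level f 1| #|level f 2| else 0%N.
Proof.
elim: b f => [|b IH] f.
  rewrite num_colorings_nil /pairs_coef muln0 addn_eq0 muln_eq0 /= !cards_eq0.
  have -> : [forall c, f c == 0%N]
    = [&& bounded2 f, level f 1 == set0 & level f 2 == set0].
    apply/forallP/and3P => [f0|[/forallP f2 /eqP/setP f1 /eqP/setP f2'] c].
      split; first by apply/forallP => c; rewrite (eqP (f0 c)).
        by apply/eqP/setP => c; rewrite !inE (eqP (f0 c)).
      by apply/eqP/setP => c; rewrite !inE (eqP (f0 c)).
    have := f2 c; have := f1 c; have := f2' c; rewrite !inE.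
    by case: (f c) => [|[|[|]]].
  case: ifP => //= _; case: eqP => //= f1; case: eqP => //= _.
  by rewrite f1 cards0.
rewrite num_colorings_cons2.
have num2 c : ((f c == 2) * num_erase (nseq b 2%N) f [:: c]
    = (c \in level f 2) * (if bounded2 f
        then pairs_coef b #|level f 1| #|level f 2|.-1 else 0))%N.
  rewrite inE; case: eqP => // fc; congr (_ * _)%N.
  rewrite /num_erase IH bounded2_erase /= ?fc //.
  by rewrite !card_level_erase_cons // fc /= subn0 subn1.
have num11 c d : ([&& d != c, f c == 1 & f d == 1]
      * num_erase (nseq b 2%N) f [:: c; d]
    = (c \in level f 1) * ((d \in level f 1 :\ c) * (if bounded2 f
        then pairs_coef b #|level f 1|.-2 #|level f 2| else 0)))%N.
  rewrite mulnA mulnb !inE andbCA; case: and3P => // -[/eqP fc dc /eqP fd].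
  congr (_ * _)%N; rewrite /num_erase IH bounded2_erase /= ?fc ?fd //.
  by rewrite !card_level_erase_cons // !inE [c == d]eq_sym dc fc fd /= !subn0
    !subn1.
under eq_bigr => c _ do rewrite num2.
rewrite sum_mem_muln.
under eq_bigr => c _.
  under eq_bigr => d _ do rewrite num11.
  rewrite -big_distrr /= sum_mem_muln.
  over.
rewrite sum_mem_cardD1.
case: ifP => _; last by rewrite !muln0.
exact: pairs_coefS.
Qed.

Lemma num_colorings_3pairs_bounded2 b f : bounded2 f ->
  num_colorings (complete_multipartite (3 :: nseq b 2)%N) f
  = (3 * (#|level f 2| * (#|level f 1|
          * pairs_coef b #|level f 1|.-1 #|level f 2|.-1))
     + #|level f 1| * (#|level f 1|.-1 * (#|level f 1|.-2
          * pairs_coef b #|level f 1|.-2.-1 #|level f 2|)))%N.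
Proof.
move=> f2; have f_le2 c : (f c <= 2)%N by apply: (forallP f2).
have num s : num_erase (nseq b 2%N) f s
    = pairs_coef b #|level (erase f s) 1| #|level (erase f s) 2|.
  by rewrite /num_erase num_colorings_pairs bounded2_erase ?f2 //; apply/allP.
rewrite num_colorings_cons3 big1 ?add0n => [|c _]; last first.
  by have := f_le2 c; case: (f c) => [|[|[|]]].
under eq_bigr => c _.
  have num21 d : ((f c == 2) * ((f d == 1) * num_erase (nseq b 2) f [:: c; d])
      = (c \in level f 2) * ((d \in level f 1)
          * pairs_coef b #|level f 1|.-1 #|level f 2|.-1))%N.
    rewrite !inE; case: eqP => // fc; case: eqP => // fd; rewrite num.
    rewrite !card_level_erase_cons // !inE.
    have -> : (c == d) = false by apply/eqP => cd; move: fd; rewrite -cd fc.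
    by rewrite fc fd /= !subn0 !subn1.
  under eq_bigr => d _ do rewrite num21.
  rewrite -big_distrr /= sum_mem_muln.
  over.
rewrite sum_mem_muln; congr (_ + _)%N.
(* The cardinality stands for the sum over the third colour, so the triple sum collapses one
   variable at a time. *)
transitivity (\sum_c (c \in level f 1) * \sum_d (d \in level f 1 :\ c)
    * (#|level f 1 :\ c :\ d|
       * pairs_coef b #|level f 1|.-2.-1 #|level f 2|))%N; last first.
  under eq_bigr => c _ do rewrite sum_mem_cardD1.
  rewrite -sum_mem_muln; apply: eq_bigr => c _.
  by case cf : (c \in level f 1) => //; rewrite (cardsD1 c (level f 1)) cf.
apply: eq_bigr => c _; rewrite big_distrr; apply: eq_bigr => d _ /=.
rewrite -sum_mem_muln !big_distrr; apply: eq_bigr => e _ /=.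
rewrite !mulnA !mulnb !inE -!andbA num.
rewrite (_ : [&& d != c, _ & _] = [&& f c == 1, d != c, f d == 1, e != d,
    e != c & f e == 1]%N); last first.
  by do 3 case: (f _ == 1%N); rewrite ?andbF ?andbT //; do 3 case: (_ != _).
case: and5P => // -[/eqP fc dc /eqP fd ed /andP[ec /eqP fe]].
rewrite !card_level_erase_cons // !inE [c == d]eq_sym [c == e]eq_sym.
rewrite [d == e]eq_sym (negPf dc) (negPf ec) (negPf ed) fc fd fe /=.
by rewrite !subn0 !subn1.
Qed.

(** The colour [c0] fits only on the partite set of size 3 and fills it, leaving a colouring of the
    pairs. *)
Lemma num_colorings_3pairs_single3 b f c0 : single3 f c0 ->
  num_colorings (complete_multipartite (3 :: nseq b 2)%N) f
  = pairs_coef b #|level f 1| #|level f 2|.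
Proof.
move=> /andP[/eqP fc0 /forall_inP f2].
have num0 s : c0 \notin s -> num_erase (nseq b 2%N) f s = 0%N.
  move=> c0s; rewrite /num_erase num_colorings_pairs ifN //.
  by apply/forallPn; exists c0; rewrite /erase (negPf c0s) fc0.
have neq c j : f c = j -> (j < 3)%N -> (c0 == c) = false.
  by move=> fc j3; apply/eqP => c0c; move: j3; rewrite -fc -c0c fc0.
rewrite num_colorings_cons3 (bigD1 c0) //= fc0 mul1n !big1 ?muln0 ?addn0.
- rewrite /num_erase num_colorings_pairs ifT.
    by rewrite !card_level_erase_cons // fc0 /= !subn0.
  apply/forallP => c; rewrite /erase inE; case: eqP => // /eqP; exact: f2.
- move=> c _; apply: big1 => d _; apply: big1 => e _.
  case: and5P => // -[_ _ _ /eqP fc /andP[/eqP fd /eqP fe]].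
  by rewrite num0 // !inE (neq c 1%N) // (neq d 1%N) // (neq e 1%N).
- move=> c _; apply: big1 => d _; case: eqP => // fc; case: eqP => // fd.
  by rewrite num0 // !inE (neq c 2%N) // (neq d 1%N).
- move=> c cc0; case: eqP => // fc.
  by move: (f2 c cc0); rewrite fc.
Qed.

(** Whatever colours the set of size 3 takes, some multiplicity above 2 is left for the pairs. *)
Lemma num_colorings_3pairs_eq0 b f :
  ~~ bounded2 f -> (forall c0, ~~ single3 f c0) ->
  num_colorings (complete_multipartite (3 :: nseq b 2)%N) f = 0%N.
Proof.
move=> f2 f3.
have num0 s : all (fun c => f c <= 2)%N s -> num_erase (nseq b 2%N) f s = 0%N.
  by move=> s2; rewrite /num_erase num_colorings_pairs bounded2_erase ?ifN.
rewrite num_colorings_cons3 !big1 // => c _.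
- apply: big1 => d _; apply: big1 => e _.
  case: and5P => // -[_ _ _ /eqP fc /andP[/eqP fd /eqP fe]].
  by rewrite num0 //= fc fd fe.
- apply: big1 => d _; case: eqP => // fc; case: eqP => // fd.
  by rewrite num0 //= fc fd.
- case: eqP => // fc; rewrite /num_erase num_colorings_pairs ifN //.
  apply/forallPn; have := f3 c; rewrite /single3 fc /= => /forall_inPn[d dc fd].
  by exists d; rewrite /erase inE (negPf dc).
Qed.

End TwoThree.

(** * Comparison of the coefficients *)

Lemma mesym2_coefE (p q t1 t2 : nat) : (t1 + 2 * t2 = p + q)%N -> (t2 <= p)%N ->
  mesym2_coef p q t1 t2 = 'C(t1, p - t2).
Proof. by move=> E le_p; rewrite /mesym2_coef E eqxx le_p. Qed.

Lemma mesym2_coef_neq (p q t1 t2 : nat) : (t1 + 2 * t2 != p + q)%N ->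
  mesym2_coef p q t1 t2 = 0%N.
Proof. by rewrite /mesym2_coef => /negPf ->. Qed.

Lemma mesym21_coef_neq (p q t1 t2 : nat) : (t1 + 2 * t2 != p + q + 1)%N ->
  mesym21_coef p q t1 t2 = 0%N.
Proof.
move=> NE; apply/eqP; rewrite addn_eq0; apply/andP; split; apply/eqP.
  by case: t2 NE => // t2 NE; rewrite mesym2_coef_neq ?muln0 //=; lia.
by case: t1 NE => // t1 NE; rewrite mesym2_coef_neq ?muln0 //=; lia.
Qed.

Lemma mesym21_coefE (p q t1 t2 : nat) : (t1 + 2 * t2 = p + q)%N ->
  (t2 <= p)%N ->
  mesym21_coef p q t1.+1 t2 = (t2 * 'C(t1.+2, (p - t2).+1) + t1.+1 * 'C(t1, p -
    t2))%N.
Proof.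
move=> E le_p; rewrite /mesym21_coef /= (mesym2_coefE E le_p); congr addn.
case: t2 E le_p => [|t2] E le_p; rewrite ?mul0n // mesym2_coefE /=; [|lia..].
by congr (_ * 'C(_, _))%N; lia.
Qed.

(** By [a_rec], the coefficients of the last sum in the theorem are the increments of [a_]. *)
Lemma a_diff (d : nat) : (2 <= d)%N ->
  (4 * d%:R - 3) * (a_ (d - 1))%:R + (a_ (d - 2))%:R
  = (a_ d)%:R - (a_ d.-1)%:R :> rat.
Proof.
case: d => [|[|d]] // _; rewrite subn1 subn2 a_rec -[_.+2.-1]/d.+1 -[_.+2.-2]/d.
by rewrite natrD (natrM _ 4) -(natr1 d.+1) -(natr1 d); ring.
Qed.

Lemma ffactn_fact (j : nat) : ((2 * j) ^_ j)%:R = (2 * j)`!%:R / j`!%:R :> rat.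
Proof.
apply: (canRL (mulfK (factn_neq0 j))); rewrite -natrM; congr (_%:R).
by rewrite -[in RHS](@ffact_fact (2 * j) j); [congr (_ * _`!)%N|]; lia.
Qed.

(** * The two numerical identities *)

Section Numeric.
Variables (beta : nat) (beta_ge1 : (1 <= beta)%N).
Let a (d : nat) : rat := (a_ d)%:R.
Let b : rat := beta%:R.

(** With t1 = 2j and j + t2 = beta the binomials become C(2j, j+d), so this is [sum_a_bin_even] for
    j. *)
Lemma coef_single3 (t1 t2 : nat) :
  (pairs_coef beta t1 t2)%:R = beta`!%:R *
    ((mesym2_coef beta.+1 beta.+1 t1 t2.+1)%:R
     + \sum_(2 <= d < beta.+1) ((4 * d%:R - 3) * a (d - 1)%N + a (d - 2)%N)
         * (mesym2_coef (beta + d + 1) (beta + 1 - d) t1 t2.+1)%:R).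
Proof.
have [E|NE] := eqVneq (t1 + 2 * t2)%N (2 * beta)%N; last first.
  rewrite pairs_coef_neq // mesym2_coef_neq; last by lia.
  rewrite big_nat_cond big1 ?addr0 ?mulr0 // => d /andP[/andP[d2 db] _].
  by rewrite mesym2_coef_neq ?mulr0 //; lia.
have [j t1E] : {j | t1 = (2 * j)%N} by exists (beta - t2)%N; lia.
rewrite {}t1E in E *.
rewrite pairs_coefE // natrM; congr (_ * _).
rewrite ffactn_fact -(@sum_a_bin_even j beta.+1) //; last by lia.
rewrite mesym2_coefE; [|lia..]; congr ('C(_, _)%:R + _); first by lia.
rewrite big_nat_cond [RHS]big_nat_cond; apply: eq_bigr => d /andP[/andP[d2 db]
  _].
by rewrite mesym2_coefE; [|lia..]; rewrite a_diff //; congr (_ * 'C(_, _)%:R);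
  lia.
Qed.

(** With t1 = 2j+1 and j + t2 = beta+1, the binomial sums are known up to their top terms. The terms
    of e_(2beta+3) and e_(2beta+2, 1) cancel exactly those. *)
Lemma coef_bounded2 (t1 t2 : nat) :
  (3 * (t2 * (t1 * pairs_coef beta t1.-1 t2.-1))
   + t1 * (t1.-1 * (t1.-2 * pairs_coef beta t1.-2.-1 t2)))%N%:R
  = beta`!%:R *
    (b * (2 * b + 3) * a beta.+1 * (mesym2_coef (2 * beta + 3) 0 t1 t2)%:R
     + b * \sum_(0 <= d < beta) (2 * d + 1)%:R * a d
             * (mesym2_coef (beta + 2 + d) (beta + 1 - d) t1 t2)%:R
     + (a beta.+1 + (2 * b ^+ 2 + b - 1) * a beta)
         * (mesym2_coef (2 * beta + 2) 1 t1 t2)%:R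
     + (mesym21_coef beta.+1 beta.+1 t1 t2)%:R
     + \sum_(2 <= d < beta.+1) ((4 * d%:R - 3) * a (d - 1)%N + a (d - 2)%N)
         * (mesym21_coef (beta + d + 1) (beta + 1 - d) t1 t2)%:R) :> rat.
Proof.
have [E|NE] := eqVneq (t1 + 2 * t2)%N (2 * beta + 3)%N; last first.
  rewrite (mesym2_coef_neq (p := 2 * beta + 3)); last by lia.
  rewrite (mesym2_coef_neq (p := 2 * beta + 2)); last by lia.
  rewrite mesym21_coef_neq; last by lia.
  rewrite big_nat_cond big1 => [|d /andP[/andP[d2 db] _]]; last first.
    by rewrite mesym2_coef_neq ?mulr0 //; lia.
  rewrite big_nat_cond big1 => [|d /andP[/andP[d2 db] _]]; last first.
    by rewrite mesym21_coef_neq ?mulr0 //; lia.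
  rewrite !(mulr0, addr0) -[RHS]/(0%:R); congr (_%:R); apply/eqP.
  rewrite addn_eq0; apply/andP; split; apply/eqP.
    by case: t1 t2 NE => [|t1] [|t2] // NE;
      rewrite ?muln0 // pairs_coef_neq ?muln0 //=; lia.
  by case: t1 NE => [|[|[|t1]]] // NE; rewrite ?muln0 // pairs_coef_neq ?muln0
    //=; lia.
have [j t1E] : {j | t1 = (2 * j).+1} by exists (beta.+1 - t2)%N; lia.
rewrite {}t1E /= in E *.
have Eb : (j + t2 = beta.+1)%N by lia.
rewrite [(t2 * _)%N]mulnCA pairs_coef_pred2; last by lia.
rewrite pairs_coef_pred11; last by lia.
pose k : rat := t2%:R; pose G : rat := ((2 * j) ^_ j)%:R.
pose C2 d : rat := 'C(2 * j + 1, j + d + 1)%:R.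
pose Ce d : rat := 'C(2 * j, j + d)%:R.
pose Ce' d : rat := 'C(2 * j.+1, j.+1 + d)%:R.
have C2E p q d : (p = beta + 2 + d)%N -> (p + q = 2 * beta + 3)%N ->
    (mesym2_coef p q (2 * j).+1 t2)%:R = C2 d.
  move=> pE pq; rewrite mesym2_coefE; [|lia..].
  by rewrite /C2 addn1; congr 'C(_, _)%:R; lia.
have CeE p q d : (p = beta + d + 1)%N -> (p + q = 2 * beta + 2)%N ->
    (mesym21_coef p q (2 * j).+1 t2)%:R = k * Ce' d + (2 * j + 1)%:R * Ce d.
  move=> pE pq; rewrite mesym21_coefE; [|lia..]; rewrite natrD !natrM addn1.
  by congr (_ * 'C(_, _)%:R + _ * 'C(_, _)%:R); lia.
rewrite (C2E _ _ beta.+1); [|lia..]; rewrite (C2E _ _ beta); [|lia..].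
rewrite (CeE _ _ 0%N); [|lia..].
(* As j may equal [beta.+1], the summation formula is used up to [beta.+1] and the two extra terms
   are subtracted. *)
have -> : \sum_(0 <= d < beta) (2 * d + 1)%:R * a d
    * (mesym2_coef (beta + 2 + d) (beta + 1 - d) (2 * j).+1 t2)%:R
    = (2 * j + 1)%:R * G - (2 * beta + 1)%:R * a beta * C2 beta
      - (2 * beta.+1 + 1)%:R * a beta.+1 * C2 beta.+1.
  have -> : (2 * j + 1)%:R * G = (2 * j + 1)`!%:R / j`!%:R.
    by rewrite /G ffactn_fact addn1 factSr mulrA.
  rewrite -(@sum_a_bin_odd j beta.+2); last by lia.
  transitivity (\sum_(0 <= d < beta) (2 * d + 1)%:R * a d * C2 d); last first.
    by rewrite big_nat_recr //= big_nat_recr //= /C2 /a; ring.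
  rewrite big_nat_cond [RHS]big_nat_cond;
    apply: eq_bigr => d /andP[/andP[d2 db] _].
  by rewrite (C2E _ _ d) //; lia.
have sumCe (i : nat) : (i < beta.+2)%N -> 'C(2 * i, i + 0)%:R
    + \sum_(2 <= d < beta.+1) ((4 * d%:R - 3) * a (d - 1)%N + a (d - 2)%N)
        * 'C(2 * i, i + d)%:R
    = ((2 * i) ^_ i)%:R - (a beta.+1 - a beta) * 'C(2 * i, i + beta.+1)%:R.
  move=> ib; rewrite ffactn_fact -(@sum_a_bin_even i beta.+2) //.
  rewrite addn0 -addrA; congr (_ + _).
  transitivity (\sum_(2 <= d < beta.+1)
    ((a_ d)%:R - (a_ d.-1)%:R) * 'C(2 * i, i + d)%:R : rat); last first.
    by rewrite [in RHS]big_nat_recr //= /a; ring.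
  rewrite big_nat_cond [RHS]big_nat_cond;
    apply: eq_bigr => d /andP[/andP[d2 db] _].
  by rewrite a_diff.
rewrite -!addrA [X in _ + (_ + (_ + X))]addrA.
have -> : k * Ce' 0 + (2 * j + 1)%:R * Ce 0%N + \sum_(2 <= d < beta.+1)
      ((4 * d%:R - 3) * a (d - 1)%N + a (d - 2)%N)
        * (mesym21_coef (beta + d + 1) (beta + 1 - d) (2 * j).+1 t2)%:R
    = 2 * k * (2 * j + 1)%:R * G + (2 * j + 1)%:R * G
      - (a beta.+1 - a beta) * C2 beta.
  transitivity (k * ('C(2 * j.+1, j.+1 + 0)%:R
      + \sum_(2 <= d < beta.+1) ((4 * d%:R - 3) * a (d - 1)%N + a (d - 2)%N)
          * 'C(2 * j.+1, j.+1 + d)%:R)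
    + (2 * j + 1)%:R * ('C(2 * j, j + 0)%:R
      + \sum_(2 <= d < beta.+1) ((4 * d%:R - 3) * a (d - 1)%N + a (d - 2)%N)
          * 'C(2 * j, j + d)%:R)).
    rewrite !mulrDr addrACA; congr (_ + _); rewrite !mulr_sumr -big_split /=.
    rewrite big_nat_cond [RHS]big_nat_cond;
      apply: eq_bigr => d /andP[/andP[d2 db] _].
    by rewrite (CeE _ _ d); [rewrite /Ce /Ce'; ring | lia..].
  (* Only [t2] equal to 0 or 1 gives nonzero binomials. *)
  have -> : C2 beta = k * Ce' beta.+1 + (2 * j + 1)%:R * Ce beta.+1.
    rewrite /C2 /Ce /Ce' /k; clear - Eb; case: t2 Eb => [|[|t]] Ebt.
    - rewrite addn0 in Ebt; rewrite Ebt mul0r add0r.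
      rewrite (_ : beta.+1 + beta + 1 = 2 * beta.+1)%N; last by lia.
      rewrite (_ : beta.+1 + beta.+1 = 2 * beta.+1)%N; last by lia.
      by rewrite binn mulr1 addn1 binSn.
    - rewrite (_ : j + beta + 1 = 2 * j + 1)%N; last by lia.
      rewrite (_ : j.+1 + beta.+1 = 2 * j.+1)%N; last by lia.
      by rewrite !binn bin_small ?mulr0 ?addr0 ?mulr1 //; lia.
    - by rewrite !bin_small ?mulr0 ?addr0 //; lia.
  rewrite (sumCe j); last by lia.
  have G_succ : ((2 * j.+1) ^_ j.+1)%:R = 2 * (2 * j + 1)%:R * G.
    rewrite /G !ffactn_fact (_ : 2 * j.+1 = (2 * j).+2)%N; last by lia.
    rewrite !factSr (_ : (2 * j).+2 = 2 * j.+1)%N; last by lia.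
    rewrite (natrM _ 2 j.+1) addn1; have := factn_neq0 j.
    have : j.+1%:R != 0 :> rat by rewrite pnatr_eq0.
    move: (j.+1%:R) (j`!%:R) ((2 * j)`!%:R) ((2 * j).+1%:R) => x y z w x0 y0.
    by field; rewrite x0 y0.
  (* For [t2 = 0] the index [j.+1] is out of range of [sumCe], but its factor [k] is 0. *)
  have [t20|t2_gt0] := posnP t2; first by rewrite /k t20 -/G /Ce; ring.
  rewrite (sumCe j.+1); last by lia.
  by rewrite G_succ -/G /Ce /Ce'; ring.
have -> : (3 * ((2 * j).+1 * (t2 * (beta`! * (2 * j) ^_ j)))
    + (2 * j).+1 * (j * (beta`! * (2 * j) ^_ j))
    = (3 * t2 + j) * ((2 * j + 1) * (beta`! * (2 * j) ^_ j)))%N by ring.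
rewrite (natrM _ (_ + _)) (natrM _ (_ + _)) (natrM _ (_ `!)) -/G.
rewrite (natrD _ (3 * t2)) (natrM _ 3 t2) -/k.
rewrite (natrD _ (2 * j)) (natrD _ (2 * beta)) (natrD _ (2 * beta.+1)).
rewrite !(natrM _ 2) -(natr1 beta) -/b.
(* After this substitution the factor b + 2k + 1 becomes j + 3k, and all terms in [C2] cancel. *)
have -> : b = j%:R + k - 1 by rewrite /b /k -natrD Eb -natr1 addrK.
by ring.
Qed.

End Numeric.

(** * Reading off coefficients of symmetric functions *)

Section SymfunCoef.
Variables (n : nat) (m : 'X_{1..n}).
Implicit Types (f g : symfun).

Definition symfun_coef f : rat := (to_vars n f)@_m.

Lemma symfun_coefD f g : symfun_coef (f + g) = symfun_coef f + symfun_coef g.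
Proof. exact: mcoeffD. Qed.

Lemma symfun_coefZ (c : rat) f : symfun_coef (c *: f) = c * symfun_coef f.
Proof. exact: mcoeffZ. Qed.

Lemma symfun_coef_sum (r : seq nat) (F : nat -> symfun) :
  symfun_coef (\sum_(i <- r) F i) = \sum_(i <- r) symfun_coef (F i).
Proof. by rewrite /symfun_coef !raddf_sum. Qed.

Lemma symfun_coef_e2 p q : symfun_coef (e_ [:: p; q])
  = (if bounded2 m then mesym2_coef p q #|level m 1| #|level m 2| else 0)%:R.
Proof.
by rewrite /symfun_coef /e_ !big_cons big_nil mulr1 rmorphM mcoeff_mesym2.
Qed.

Lemma symfun_coef_e1 p : symfun_coef (e_ [:: p])
  = (if bounded2 m then mesym2_coef p 0 #|level m 1| #|level m 2| else 0)%:R.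
Proof.
rewrite /symfun_coef /e_ big_cons big_nil mulr1 -mcoeff_mesym2 mesym0E mulr1.
by [].
Qed.

Lemma symfun_coef_e3 p q : symfun_coef (e_ [:: p; q; 1%N])
  = (mesym n rat p * mesym n rat q * mesym n rat 1)@_m.
Proof. by rewrite /symfun_coef /e_ !big_cons big_nil mulr1 mulrA !rmorphM. Qed.

End SymfunCoef.

Definition symfun_coefE :=
  (symfun_coefD, symfun_coefZ, symfun_coef_sum, symfun_coef_e1, symfun_coef_e2).


Theorem theorem1p2 (beta : nat) (beta_ge1 : (1 <= beta)%N) :
  let K := complete_multipartite (3 :: nseq beta 2)%N in
  let a (d : nat) : rat := (a_ d)%:R in
  let b : rat := beta%:R in
  chromatic_symfun K =
    (beta`!)%:R *:
      ((b * (2 * b + 3) * a beta.+1) *: e_ [:: (2 * beta + 3)%N]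
       + b *: (\sum_(0 <= d < beta)
                 ((2 * d + 1)%:R * a d) *:
                 e_ [:: (beta + 2 + d)%N; (beta + 1 - d)%N])
       + (a beta.+1 + (2 * b ^+ 2 + b - 1) * a beta) *:
           e_ [:: (2 * beta + 2)%N; 1%N]
       + e_ [:: beta.+1; beta.+1; 1%N]
       + \sum_(2 <= d < beta.+1)
           ((4 * d%:R - 3) * a (d - 1)%N + a (d - 2)%N) *:
           e_ [:: (beta + d + 1)%N; (beta + 1 - d)%N; 1%N])
  /\ e_positive K.
Proof.
move=> K a b; set Y := (Y in _ = Y).
have a_ge0 d : 0 <= a d by [].
have b_ge1 : 1 <= b by rewrite ler1n.
have XY : chromatic_symfun K = Y.
  apply: symfunP => n; apply/mpolyP => m.
  rewrite -/(to_vars n Y) -/(symfun_coef m Y) {}/Y.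
  rewrite [LHS]mcoeff_chromatic !symfun_coefE.
  under [X in _ + X]eq_bigr => d _ do rewrite symfun_coefZ symfun_coef_e3.
  under [X in _ + b * X + _]eq_bigr => d _ do rewrite symfun_coefZ
    symfun_coef_e2.
  rewrite symfun_coef_e3.
  have [m2|m2] := boolP (bounded2 m).
    rewrite num_colorings_3pairs_bounded2 // coef_bounded2 //.
    rewrite mcoeff_mesym21_bounded2 //.
    by under [X in _ = _ * (_ + X)]eq_bigr => d _ do rewrite
      mcoeff_mesym21_bounded2 //.
  (* An exponent above 2 kills all products of at most two elementary functions. *)
  rewrite !mulr0 [X in b * X]big1 ?mulr0 ?add0r => [|d _];
    last by rewrite mulr0.
  have [c0 m3|m3] := pickP (single3 m).
    rewrite (num_colorings_3pairs_single3 _ m3) coef_single3 //.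
    rewrite (mcoeff_mesym21_single3 _ _ m3).
    by under [X in _ = _ * (_ + X)]eq_bigr => d _ do rewrite
      (mcoeff_mesym21_single3 _ _ m3).
  have {}m3 c0 : ~~ single3 m c0 by rewrite m3.
  rewrite num_colorings_3pairs_eq0 // mcoeff_mesym21_eq0 // add0r.
  by rewrite big1 ?mulr0 // => d _; rewrite mcoeff_mesym21_eq0 // mulr0.
(* In the expansion only 2b^2+b-1 and 4d-3 involve subtraction; they are nonnegative since b >= 1
   and d >= 2. *)
split=> //; rewrite /e_positive XY; apply: e_nonnegP.
apply: e_nonneg_combinationZ => //.
do ![apply: e_nonneg_combinationD].
- apply: e_nonneg_combinationZ; first by rewrite !mulr_ge0 //; lra.
  by apply: e_nonneg_combination_e; rewrite /is_partition /= !inE; lia.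
- apply: e_nonneg_combinationZ; first by lra.
  apply: e_nonneg_combination_sum => d; rewrite mem_index_iota => /andP[_ db].
  apply: e_nonneg_combinationZ; first by rewrite mulr_ge0.
  by apply: e_nonneg_combination_e; rewrite /is_partition /= !inE; lia.
- apply: e_nonneg_combinationZ.
    by rewrite addr_ge0 // mulr_ge0 //; nra.
  by apply: e_nonneg_combination_e; rewrite /is_partition /= !inE; lia.
- by apply: e_nonneg_combination_e; rewrite /is_partition /= ?inE; lia.
apply: e_nonneg_combination_sum => d; rewrite mem_index_iota => /andP[d2 db].
apply: e_nonneg_combinationZ.
  have : 2 <= d%:R :> rat by rewrite (ler_nat _ 2).
  by move=> d2'; rewrite addr_ge0 // mulr_ge0 //; lra.
by apply: e_nonneg_combination_e; rewrite /is_partition /= !inE; lia.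
Qed.
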